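(* Let $s$ be a nonnegative integer and $r$ a positive integer. Let $f\in R^\circ_r(z)$ with $\mathrm{ord}(f)=-s/r$ and $f\neq 0$ (in the quotient defining $R_r(z)$). Then $E_f\in\mathcal{C}_0$ and $$\mathcal{F}^{(0,\infty)}(E_f)\simeq E_g,$$ where $g\in R^\circ_{r+s}(\hat\zeta)$ is determined by the system of equations $$f=-z\hat z,\qquad g=f+\frac{s}{2(r+s)}.$$ Here $\hat\zeta=1/\hat z$, and the system is read as follows: the first equation is solved to express $z$ in terms of $\hat\zeta^{1/(r+s)}$, and this expression is substituted in the second equation to obtain $g$ in terms of $\hat\zeta^{1/(r+s)}$. Explicitly, choose a representative $f=F(z^{1/r})$ with $F\in\Bbbk((t))$ of order $-s$, let $u\in\Bbbk((\hat\zeta^{1/(r+s)}))$ (playing the role of $z^{1/r}$), of order $1/(r+s)$ in $\hat\zeta$, be a solution of $F(u)=-u^r\hat\zeta^{-1}$; then $g$ is the class of $F(u)+\frac{s}{2(r+s)}$. (Different choices of the solution $u$ give the same Galois orbit.)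
   Context: $\Bbbk$ is an algebraically closed field of characteristic zero. For a local coordinate $x$ put $K=\Bbbk((x))$ and, for a positive integer $q$, $K_q=\Bbbk((x^{1/q}))$, with $\mathrm{ord}$ the order in $x$ (so $\mathrm{ord}(x^{1/q})=1/q$). A connection on a finite-dimensional $K$-vector space $V$ is a $\Bbbk$-linear map $\nabla:V\to V$ with $\nabla(hv)=h\nabla(v)+\frac{dh}{dx}v$ for $h\in K$, $v\in V$. $\mathcal{C}$ is the category of pairs $(V,\nabla)$, with morphisms the $K$-linear maps commuting with the connections. $\mathcal{C}_0$ denotes $\mathcal{C}$ with coordinate $z$ (at the point zero); $\mathcal{C}_\infty$ denotes $\mathcal{C}$ with the coordinate at infinity (here $\hat\zeta$); $\mathcal{C}_\infty^{<1}$ is the full subcategory of connections all of whose irreducible components have slope less than one. For $f\in K_q$, $E_f=E_{f,q}=\left(K_q,\frac{d}{dx}+x^{-1}f\right)\in\mathcal{C}$ (with $K_q$ viewed as a $K$-vector space). $R_q(x)$ is the set of orbits of $\mathrm{Gal}(K_q/K)$ (the $q$-th roots of unity $\eta\in\Bbbk$, acting by $f(x^{1/q})\mapsto f(\eta x^{1/q})$) on the quotient $$\Bbbk((x^{1/q}))\Big/\left(x^{1/q}\Bbbk[[x^{1/q}]]+\tfrac1q\mathbb{Z}\right).$$ $R_q^\circ(x)\subset R_q(x)$ is the set of $f\in R_q(x)$ that cannot be represented by elements of $K_{q'}$ for any $0<q'<q$ (equivalently, the locus where $\mathrm{Gal}(K_q/K)$ acts freely). The isomorphism class of $E_f$ depends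 only on the class of $f$ in $R_q(x)$. Local Fourier transform $\mathcal{F}^{(0,\infty)}$: let $E=(V,\nabla_z)\in\mathcal{C}_0$ be such that $\nabla_z$ has no horizontal sections; then $\nabla_z$ is invertible. Define $\Bbbk$-linear operators on $V$ by $\hat\zeta=-\nabla_z^{-1}$ and $\hat\nabla_{\hat\zeta}=-\hat\zeta^{-2}z$. The operator $\hat\zeta$ extends to an action of $\Bbbk((\hat\zeta))$ on $V$ with $\dim_{\Bbbk((\hat\zeta))}V<\infty$, and $\hat\nabla_{\hat\zeta}$ is a connection on the resulting $\Bbbk((\hat\zeta))$-vector space $V_{\hat\zeta}$. Then $\mathcal{F}^{(0,\infty)}(E):=(V_{\hat\zeta},\hat\nabla_{\hat\zeta})\in\mathcal{C}_\infty^{<1}$. The Fourier coordinate of $z$ is $\hat z$ and $\hat\zeta=1/\hat z$. *)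

(* Defs.v *)
From HB Require Import structures.
From mathcomp Require Import all_boot all_order all_algebra.
From mathcomp Require Import boolp classical_sets functions cardinality fsbigop.
From mathcomp Require Import zify ring.

Set Implicit Arguments.
Unset Strict Implicit.
Unset Printing Implicit Defensive.

Import Order.TTheory GRing.Theory Num.Theory.
Local Open Scope ring_scope.
Local Open Scope classical_set_scope.

Definition lbound (k : fieldType) (a : int -> k) (N : int) : Prop :=
  forall n, n < N -> a n = 0.

(* Formal Laurent series k((t)): [a n] is the coefficient of t^n. *)
Record laurent (k : fieldType) := Laurent {
  lcoef :> int -> k;
  lcoefP : exists N, lbound lcoef N }.

HB.instance Definition _ (k : fieldType) := gen_eqMixin (laurent k).
HB.instance Definition _ (k : fieldType) := gen_choiceMixin (laurent k).

Definition lorder (k : fieldType) (a : laurent k) (n : int) : Prop :=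
  a n != 0 /\ lbound a n.

Section LaurentRing.
Variable k : fieldType.
Implicit Types a b : laurent k.

Lemma laurentP a b : a =1 b -> a = b.
Proof.
case: a b => [a Pa] [b Pb] /= /funext ab; rewrite -{}ab in Pb *.
by congr Laurent; exact: Prop_irrelevance.
Qed.

Lemma lbound_le (a : int -> k) (N M : int) : M <= N -> lbound a N -> lbound a M.
Proof. by move=> MN aN n nM; apply: aN; apply: lt_le_trans MN. Qed.

Lemma ladd_subproof a b : exists N, lbound (fun n => a n + b n) N.
Proof.
have [[N aN] [M bM]] := (lcoefP a, lcoefP b).
by exists (Order.min N M) => n; rewrite lt_min => /andP[/aN-> /bM->]; rewrite addr0.
Qed.
Definition ladd a b := Laurent (ladd_subproof a b).

Lemma lopp_subproof a : exists N, lbound (fun n => - a n) N.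
Proof. by have [N aN] := lcoefP a; exists N => n /aN->; rewrite oppr0. Qed.
Definition lopp a := Laurent (lopp_subproof a).

Lemma lmono_subproof (x : k) (p : int) :
  exists N, lbound (fun n : int => if n == p then x else 0) N.
Proof. by exists p => n np; rewrite lt_eqF. Qed.
Definition lmono x p := Laurent (lmono_subproof x p).
Definition lconst x := lmono x 0.

Lemma laddA : associative ladd.
Proof. by move=> a b c; apply: laurentP => n /=; rewrite addrA. Qed.
Lemma laddC : commutative ladd.
Proof. by move=> a b; apply: laurentP => n /=; rewrite addrC. Qed.
Lemma ladd0 : left_id (lconst 0) ladd.
Proof. by move=> a; apply: laurentP => n /=; rewrite if_same add0r. Qed.
Lemma laddN : left_inverse (lconst 0) lopp ladd.
Proof. by move=> a; apply: laurentP => n /=; rewrite if_same addNr. Qed.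

HB.instance Definition _ :=
  GRing.isZmodule.Build (laurent k) laddA laddC ladd0 laddN.

Lemma lcoef0 n : (0 : laurent k) n = 0.
Proof. by rewrite /= if_same. Qed.
Lemma lcoefD a b n : (a + b) n = a n + b n.
Proof. by []. Qed.
Lemma lcoefN a n : (- a) n = - a n.
Proof. by []. Qed.
Lemma lcoefB a b n : (a - b) n = a n - b n.
Proof. by []. Qed.

(* The Cauchy product; the sum has finite support for Laurent series. *)
Definition conv (a b : int -> k) (n : int) : k :=
  \sum_(i \in [set: int]) a i * b (n - i).

Lemma conv_sumE (a b : int -> k) (N M n : int) (L : nat) :
    lbound a N -> lbound b M -> n - N - M < L%:Z ->
  conv a b n = \sum_(j < L) a (N + j%:Z) * b (n - N - j%:Z).
Proof.
move=> aN bM nL; rewrite /conv.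
pose r := [seq N + j%:Z | j <- iota 0 L].
have ur : uniq r by rewrite map_inj_uniq ?iota_uniq // => x y /addrI[].
rewrite -(fsbig_widen [set` r]) //; last first.
  move=> i [_ /= /negP ir].
  have [/aN->|Ni] := ltP i N; first by rewrite mul0r.
  have [Li|iL] := leP (N + L%:Z) i.
    by rewrite (bM (n - i)) ?mulr0 //; lia.
  case/negP: ir; apply/mapP; exists (absz (i - N)%R); last by lia.
  by rewrite mem_iota; lia.
rewrite -fsbig_seq // big_map -{1}[L]subn0 big_mkord.
by apply: eq_bigr => j _; congr (_ * b _); lia.
Qed.

Lemma conv_lbound (a b : int -> k) (N M : int) :
  lbound a N -> lbound b M -> lbound (conv a b) (N + M).
Proof.
move=> aN bM n nNM; rewrite (@conv_sumE _ _ N M _ 0) ?big_ord0 //; lia.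
Qed.

Definition lpoly (a : int -> k) (N : int) (L : nat) : {poly k} :=
  \poly_(i < L) a (N + i%:Z).

Lemma conv_polyE (a b : int -> k) (N M : int) (L m : nat) :
    lbound a N -> lbound b M -> (m < L)%N ->
  conv a b (N + M + m%:Z) = (lpoly a N L * lpoly b M L)`_m.
Proof.
move=> aN bM mL; rewrite (@conv_sumE _ _ N M _ m.+1) //; last by lia.
rewrite coefM; apply: eq_bigr => j _; rewrite !coef_poly.
have jm := ltn_ord j; rewrite !ifT; [|lia..].
by congr (_ * b _); lia.
Qed.

Lemma coefM_eq (p p' q q' : {poly k}) (m : nat) :
    (forall i, (i <= m)%N -> p`_i = p'`_i) ->
    (forall i, (i <= m)%N -> q`_i = q'`_i) -> (p * q)`_m = (p' * q')`_m.
Proof.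
move=> pp' qq'; rewrite !coefM; apply: eq_bigr => j _.
by rewrite pp' ?qq' ?leq_subr // -ltnS.
Qed.

Lemma lmul_subproof a b : exists N, lbound (conv a b) N.
Proof.
have [[N aN] [M bM]] := (lcoefP a, lcoefP b).
by exists (N + M); apply: conv_lbound.
Qed.
Definition lmul a b := Laurent (lmul_subproof a b).

Lemma lmulC : commutative lmul.
Proof.
move=> a b; apply: laurentP => n /=.
have [[N aN] [M bM]] := (lcoefP a, lcoefP b).
have [nl|nl] := ltP n (N + M).
  by rewrite (conv_lbound aN bM) ?(conv_lbound bM aN) //; lia.
have -> : n = N + M + (absz (n - N - M)%R)%:Z by lia.
rewrite (conv_polyE aN bM (ltnSn _)) [N + M]addrC (conv_polyE bM aN (ltnSn _)).
by rewrite mulrC.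
Qed.

Lemma lmulA : associative lmul.
Proof.
move=> a b c; apply: laurentP => n /=.
have [[N aN] [M bM] [Q cQ]] := And3 (lcoefP a) (lcoefP b) (lcoefP c).
have abNM := conv_lbound aN bM; have bcMQ := conv_lbound bM cQ.
have [nl|nl] := ltP n (N + M + Q).
  rewrite (conv_lbound aN bcMQ) ?(conv_lbound abNM cQ) //; lia.
have -> : n = N + (M + Q) + (absz (n - N - M - Q)%R)%:Z by lia.
set m := absz _; rewrite (conv_polyE aN bcMQ (ltnSn m)) addrA.
rewrite (conv_polyE abNM cQ (ltnSn m)).
rewrite (@coefM_eq _ (lpoly a N m.+1) _ (lpoly b M m.+1 * lpoly c Q m.+1)) //.
  rewrite mulrA; apply: coefM_eq => // i im.
  by rewrite coef_poly ltnS im (conv_polyE aN bM (L := m.+1)).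
by move=> i im; rewrite coef_poly ltnS im (conv_polyE bM cQ (L := m.+1)).
Qed.

Lemma lmonoM_coef x p a n : conv (lmono x p) a n = x * a (n - p).
Proof.
rewrite /conv -(fsbig_widen [set p]) //= ?fsbig_set1 ?eqxx //.
by move=> i [_ /= /eqP/negPf->]; rewrite mul0r.
Qed.

Lemma lmul1 : left_id (lconst 1) lmul.
Proof. by move=> a; apply: laurentP => n; rewrite /= lmonoM_coef mul1r subr0. Qed.

Lemma lmulDl : left_distributive lmul ladd.
Proof.
move=> a b c; apply: laurentP => n /=.
have [[N0 aN0] [M0 bM0] [Q cQ]] := And3 (lcoefP a) (lcoefP b) (lcoefP c).
pose N := Order.min N0 M0.
have aN : lbound a N by apply: lbound_le aN0; rewrite ge_min lexx.
have bN : lbound b N by apply: lbound_le bM0; rewrite ge_min lexx orbT.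
have abN : lbound (fun n => a n + b n) N by move=> i iN; rewrite aN ?bN ?addr0.
pose L := (absz (n - N - Q)%R).+1; have nL : n - N - Q < L%:Z by rewrite /L; lia.
rewrite (conv_sumE aN cQ nL) (conv_sumE bN cQ nL) (conv_sumE abN cQ nL).
by rewrite -big_split; apply: eq_bigr => j _; rewrite /= mulrDl.
Qed.

Lemma loner_neq0 : lconst 1 != 0 :> laurent k.
Proof.
by apply/eqP => /(congr1 (fun a : laurent k => a 0)) /= /eqP; rewrite oner_eq0.
Qed.

HB.instance Definition _ := GRing.Zmodule_isComNzRing.Build (laurent k)
  lmulA lmulC lmul1 lmulDl loner_neq0.

Lemma lcoefM a b n : (a * b) n = \sum_(i \in [set: int]) a i * b (n - i).
Proof. by []. Qed.

Lemma lcoef1 n : (1 : laurent k) n = (n == 0)%:R.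
Proof. by rewrite /=; case: eqP. Qed.

Lemma lcoef_monoM x p a n : (lmono x p * a) n = x * a (n - p).
Proof. exact: lmonoM_coef. Qed.

Lemma lboundM a b (N M : int) :
  lbound a N -> lbound b M -> lbound (a * b) (N + M).
Proof. exact: conv_lbound. Qed.

Lemma lorder_exists a : a != 0 -> exists n, lorder a n.
Proof.
move=> a0; have [N aN] := lcoefP a.
have ex : exists n : nat, a (N + n%:Z) != 0.
  apply: contrapT => nex; move/eqP: a0; apply; apply: laurentP => n.
  rewrite lcoef0; have [/aN //|Nn] := ltP n N.
  apply/eqP; rewrite -[_ == _]negbK; apply/negP => an; apply: nex.
  by exists (absz (n - N)%R); rewrite (_ : N + _ = n) //; lia.
exists (N + (ex_minn ex)%:Z); case: ex_minnP => m am mmin; split=> // n nm.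
have [/aN //|Nn] := ltP n N.
apply/eqP; rewrite -[_ == _]negbK; apply/negP => an.
have := mmin (absz (n - N)%R); rewrite (_ : N + _ = n); last by lia.
by move=> /(_ an); lia.
Qed.

Fixpoint inv_seq (c : nat -> k) (n : nat) : seq k :=
  if n is m.+1 then
    let s := inv_seq c m in
    rcons s ((c 0)^-1 * ((m == 0)%:R - \sum_(i < m) s`_i * c (m - i)%N))
  else [::].
Definition inv_coef c n := (inv_seq c n.+1)`_n.

Lemma size_inv_seq c n : size (inv_seq c n) = n.
Proof. by elim: n => //= n IH; rewrite size_rcons IH. Qed.

Lemma inv_seqE c n i : (i < n)%N -> (inv_seq c n)`_i = inv_coef c i.
Proof.
elim: n => // n IH; rewrite ltnS leq_eqVlt => /predU1P[-> //|iN].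
by rewrite [inv_seq c n.+1]/= nth_rcons size_inv_seq iN IH.
Qed.

Lemma inv_coefP c m : c 0%N != 0 ->
  \sum_(i < m.+1) inv_coef c i * c (m - i)%N = (m == 0)%:R.
Proof.
move=> c0; rewrite big_ord_recr /= subnn {2}/inv_coef /=.
rewrite nth_rcons size_inv_seq ltnn eqxx mulrAC mulVf // mul1r.
under [X in _ - X]eq_bigr => i _ do rewrite inv_seqE ?ltn_ord //.
by rewrite addrC subrK.
Qed.

Lemma linv_exists a : a != 0 -> exists b, b * a = 1.
Proof.
case/lorder_exists => v [av0 av].
pose c (n : nat) := a (v + n%:Z).
pose bc (n : int) := if n < - v then 0 else inv_coef c (absz (n + v)%R).
have bv : lbound bc (- v) by move=> n nv; rewrite /bc nv.
exists (Laurent (ex_intro _ _ bv)); apply: laurentP => n; rewrite lcoef1 /=.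
have [n0|n0] := ltP n 0.
  by rewrite (conv_lbound bv av) ?addNr // lt_eqF.
pose m := absz n; have nm : n = m%:Z by rewrite /m; lia.
rewrite (@conv_sumE _ _ _ _ _ m.+1 bv av); last by lia.
rewrite (_ : n == 0 = (m == 0)%N); last by lia.
have c0 : c 0%N != 0 by rewrite /c addr0.
rewrite -(inv_coefP m c0); apply: eq_bigr => j _.
have jm := ltn_ord j; rewrite /bc ifF; last by lia.
by congr (inv_coef _ _ * a _); lia.
Qed.

Definition linv a : laurent k :=
  match pselect (a != 0) with
  | left a0 => projT1 (cid (linv_exists a0))
  | right _ => 0
  end.

Lemma lmulVf a : a != 0 -> linv a * a = 1.
Proof. by move=> a0; rewrite /linv; case: pselect => // a0'; case: cid. Qed.
Lemma linv0 : linv 0 = 0.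
Proof. by rewrite /linv; case: pselect => // n0; case/eqP: (n0). Qed.

HB.instance Definition _ :=
  GRing.ComNzRing_isField.Build (laurent k) lmulVf linv0.

Lemma lcoef_sum (I : finType) (F : I -> laurent k) n :
  (\sum_i F i) n = \sum_i F i n.
Proof. by apply: (big_morph (fun a : laurent k => a n)) => //; rewrite lcoef0. Qed.

Lemma theta_subproof a : exists N, lbound (fun n : int => n%:~R * a n) N.
Proof. by have [N aN] := lcoefP a; exists N => n /aN->; rewrite mulr0. Qed.
Definition theta a : laurent k := Laurent (theta_subproof a).

Lemma thetaM a b : theta (a * b) = theta a * b + a * theta b.
Proof.
apply: laurentP => n.
have [[N aN] [M bM]] := (lcoefP a, lcoefP b).
have taN : lbound (theta a) N by move=> i /aN /= ->; rewrite mulr0.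
have tbM : lbound (theta b) M by move=> i /bM /= ->; rewrite mulr0.
pose L := (absz (n - N - M)%R).+1; have nL : n - N - M < L%:Z by rewrite /L; lia.
rewrite lcoefD -[LHS]/(n%:~R * conv a b n).
rewrite -[X in X + _]/(conv (theta a) b n) -[X in _ + X]/(conv a (theta b) n).
rewrite (conv_sumE aN bM nL) (conv_sumE taN bM nL) (conv_sumE aN tbM nL).
rewrite mulr_sumr -big_split; apply: eq_bigr => j _ /=.
have -> : n%:~R = (N + j%:Z)%:~R + (n - N - j%:Z)%:~R :> k.
  by rewrite -intrD; congr (_%:~R); lia.
by ring.
Qed.

End LaurentRing.

Definition lX {k : fieldType} : laurent k := lmono 1 1.

(* For q = 0 the constructions indexed by q below take q = 1 instead, so that
   they make sense for every natural number. *)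
Definition ramdeg (q : nat) : nat := q.-1.+1.

(* Puiseux series K_q = k((x^(1/q))), written as Laurent series in
   t = x^(1/q). *)
Definition puiseux (k : fieldType) (q : nat) := laurent k.
HB.instance Definition _ (k : fieldType) (q : nat) :=
  GRing.Field.copy (puiseux k q) (laurent k).

Section Ramification.
Variables (k : fieldType) (q : nat).
Implicit Types (a b h : laurent k) (v : puiseux k q).
Let d : nat := ramdeg q.

Lemma ramdeg_gt0 : 0 < d%:Z. Proof. by []. Qed.

Lemma ramify_subproof a :
  exists N, lbound (fun n : int => if (d %| n)%Z then a (n %/ d)%Z else 0) N.
Proof.
have [N aN] := lcoefP a; exists (N * d%:Z) => n nN; case: ifP => // /divzK dn.
by apply: aN; rewrite -(ltr_pM2r ramdeg_gt0) dn.
Qed.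

(* The inclusion of k((x)) in K_q, i.e. a(t) |-> a(t^q). *)
Definition ramify a : puiseux k q := Laurent (ramify_subproof a).

Lemma ramify_mul a (m : int) : ramify a (m * d%:Z) = a m.
Proof. by rewrite /= dvdz_mull // mulzK. Qed.

Lemma ramify_dvd a (n : int) : ~~ (d %| n)%Z -> ramify a n = 0.
Proof. by rewrite /= => /negPf->. Qed.

Lemma ramify_coefM a (b : laurent k) n :
  (ramify a * b : laurent k) n =
  \sum_(j \in [set: int]) a j * b (n - j * d%:Z).
Proof.
rewrite lcoefM -(fsbig_widen [set j * d%:Z | j in [set: int]]) //; last first.
  move=> i [_ ni]; change (ramify a i * b (n - i) = 0).
  rewrite ramify_dvd ?mul0r //.
  by apply/negP => /divzK di; apply: ni; exists (i %/ d)%Z.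
rewrite fsbig_image; last by move=> x y _ _; apply: mulIf.
by apply: eq_fsbigr => j _; rewrite ramify_mul.
Qed.

Lemma ramifyD a b : ramify (a + b) = ramify a + ramify b.
Proof. by apply: laurentP => n /=; case: ifP => // _; rewrite addr0. Qed.

Lemma ramifyM a b : ramify (a * b) = ramify a * ramify b.
Proof.
apply: laurentP => n; rewrite ramify_coefM.
have [/divzK dn|dn] := boolP (d %| n)%Z.
  rewrite -dn ramify_mul lcoefM; apply: eq_fsbigr => j _.
  by rewrite -mulrBl ramify_mul.
rewrite ramify_dvd // fsbig1 // => j _.
by rewrite ramify_dvd ?mulr0 // dvdzE -dvdzE rpredBr ?dvdz_mull.
Qed.

Lemma ramify_const (x : k) : ramify (lconst x) = lconst x.
Proof.
apply: laurentP => n /=; have [/divzK dn|dn] := boolP (d %| n)%Z.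
  by rewrite -{2}dn mulf_eq0 orbF.
by case: eqP dn => // ->; rewrite dvdz0.
Qed.

Definition pscale h v : puiseux k q := ramify h * v.

Lemma pscaleA a b v : pscale a (pscale b v) = pscale (a * b) v.
Proof. by rewrite /pscale ramifyM mulrA. Qed.
Lemma pscale1 : left_id 1 pscale.
Proof. by move=> v; rewrite /pscale ramify_const mul1r. Qed.
Lemma pscaleDr : right_distributive pscale +%R.
Proof. by move=> a u v; rewrite /pscale mulrDr. Qed.
Lemma pscaleDl v : {morph pscale^~ v : a b / a + b}.
Proof. by move=> a b; rewrite /pscale ramifyD mulrDl. Qed.

HB.instance Definition _ := GRing.Zmodule_isLmodule.Build (laurent k)
  (puiseux k q) pscaleA pscale1 pscaleDr pscaleDl.

Lemma pscaleE h v : h *: v = ramify h * v.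
Proof. by []. Qed.

Lemma slice_subproof (i : 'I_d) v :
  exists N, lbound (fun m : int => v (m * d%:Z + i%:Z)) N.
Proof.
have [N vN] := lcoefP v; exists (- (absz N)%:Z - 1) => m mN; apply: vN.
have i_lt := ltn_ord i; have d_gt0 : (0 < d)%N by []; nia.
Qed.
Definition slice i v : laurent k := Laurent (slice_subproof i v).

Definition to_row v : 'rV[laurent k]_d := \row_i slice i v.
Definition of_row (w : 'rV[laurent k]_d) : puiseux k q :=
  \sum_(i < d) (ramify (w 0 i) * lmono 1 i%:Z).

Lemma to_row_linear : linear to_row.
Proof.
move=> a u v; apply/rowP => i; rewrite !mxE; apply: laurentP => m.
rewrite lcoefD lcoefM /= -/(ramify a * u) ; congr (_ + _).
rewrite -[LHS]/((ramify a * u : laurent k) _) ramify_coefM.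
by apply: eq_fsbigr => j _; congr (_ * u _); ring.
Qed.

Lemma absz_mod_lt n : (absz (n %% d)%Z < d)%N.
Proof.
by have := ltz_pmod n ramdeg_gt0; have := modz_ge0 n (lt0r_neq0 ramdeg_gt0); lia.
Qed.

Lemma of_row_coef w n :
  of_row w n = w 0 (inord (absz (n %% d)%Z)) (n %/ d)%Z.
Proof.
rewrite /of_row (lcoef_sum (fun i => ramify (w 0 i) * lmono 1 i%:Z)).
have nd := absz_mod_lt n.
set i0 := inord _; have i0E : i0%:Z = (n %% d)%Z.
  by rewrite inordK // gez0_abs // modz_ge0.
rewrite (bigD1 i0) // big1 => [|i ii0].
  rewrite [LHS]addr0 mulrC lcoef_monoM mul1r i0E {1}(divz_eq n d) addrK.
  exact: ramify_mul.
rewrite -[LHS]/((ramify (w 0 i) * lmono 1 i%:Z : laurent k) n).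
rewrite mulrC lcoef_monoM mul1r ramify_dvd //.
apply: contra ii0 => din; apply/eqP/val_inj/eqP; rewrite -eqz_nat i0E.
rewrite -[i%:Z](modz_small (d := d%:Z)) ?ltz_nat ?ltn_ord // eq_sym.
by rewrite eqz_mod_dvd.
Qed.

Lemma to_rowK : cancel to_row of_row.
Proof.
move=> v; apply: laurentP => n; rewrite of_row_coef mxE /=.
rewrite inordK; last exact: absz_mod_lt.
by rewrite gez0_abs ?modz_ge0 // -divz_eq.
Qed.

Lemma of_rowK : cancel of_row to_row.
Proof.
move=> w; apply/rowP => i; rewrite mxE; apply: laurentP => m.
rewrite -[LHS]/(of_row w (m * d%:Z + i%:Z)) of_row_coef.
rewrite divzMDl // modzMDl divz_small ?ltz_nat ?ltn_ord // addr0.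
by rewrite modz_small ?ltz_nat ?ltn_ord //= inord_val.
Qed.

Lemma puiseux_vectP : Vector.axiom d (puiseux k q).
Proof. by exists to_row; [exact: to_row_linear|exists of_row; [exact: to_rowK|exact: of_rowK]]. Qed.

HB.instance Definition _ :=
  Lmodule_hasFinDim.Build (laurent k) (puiseux k q) puiseux_vectP.

Lemma pderiv_subproof v :
  exists N, lbound (fun n : int => (n + d%:Z)%:~R / d%:R * v (n + d%:Z)) N.
Proof.
have [N vN] := lcoefP v; exists (N - d%:Z) => n nN.
by rewrite vN ?mulr0 // -ltrBrDr.
Qed.

(* d/dx on K_q: t^n |-> (n/q) t^(n-q). *)
Definition pderiv v : puiseux k q := Laurent (pderiv_subproof v).

Lemma pderivE v : pderiv v = lmono d%:R^-1 (- d%:Z) * theta v.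
Proof.
by apply: laurentP => n; rewrite lcoef_monoM opprK /= mulrA [_ / _]mulrC.
Qed.

End Ramification.

Lemma theta_ramify (k : fieldType) (q : nat) (a : laurent k) :
  theta (ramify q a) = lconst (ramdeg q)%:R * ramify q (theta a).
Proof.
apply: laurentP => n; rewrite lcoef_monoM subr0 /=; case: ifP => [/divzK dn|_].
  by rewrite -{1}dn rmorphM /= mulrA [_ * (_ %:~R)]mulrC.
by rewrite !mulr0.
Qed.

Lemma ramify_mono (k : fieldType) (q : nat) (x : k) (p : int) :
  ramify q (lmono x p) = lmono x (p * (ramdeg q)%:Z).
Proof.
apply: laurentP => n /=; case: ifPn => [/divzK dn|dn].
  by rewrite -{2}dn (inj_eq (mulIf _)).
by case: eqP dn => // ->; rewrite dvdz_mull.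
Qed.

Lemma lmonoM (k : fieldType) (x y : k) (p r : int) :
  lmono x p * lmono y r = lmono (x * y) (p + r).
Proof.
apply: laurentP => n; rewrite lcoef_monoM /= subr_eq addrC.
by case: eqP => // _; rewrite mulr0.
Qed.

Definition lderiv (k : fieldType) (h : laurent k) : laurent k := pderiv (q := 1) h.

Lemma pderivD (k : fieldType) (q : nat) (u v : puiseux k q) :
  pderiv (u + v) = pderiv u + pderiv v.
Proof. by apply: laurentP => n /=; rewrite mulrDr. Qed.

Lemma ramdeg_neq0 (k : fieldType) (q : nat) :
  [pchar k] =i pred0 -> (ramdeg q)%:R != 0 :> k.
Proof. by move=> /pcharf0P->. Qed.

Lemma pderivZ (k : fieldType) (q : nat) (hk : [pchar k] =i pred0)
    (h : laurent k) (v : puiseux k q) :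
  pderiv (h *: v) = h *: pderiv v + lderiv h *: v.
Proof.
rewrite !pscaleE /lderiv !pderivE thetaM theta_ramify ramifyM ramify_mono mulN1r.
rewrite invr1 mulrDr addrC; congr (_ + _); first by rewrite mulrCA.
rewrite !mulrA lmonoM addr0 mulVf ?ramdeg_neq0 //.
Qed.

(* Objects of the category C over K = k((x)). *)
Record connection (k : fieldType) := Connection {
  conn_space :> vectType (laurent k);
  nabla : conn_space -> conn_space;
  nabla_linear : forall (c : k) (u v : conn_space),
    nabla (lconst c *: u + v) = lconst c *: nabla u + nabla v;
  nabla_leibniz : forall (h : laurent k) (v : conn_space),
    nabla (h *: v) = h *: nabla v + lderiv h *: v }.

Definition conn_isom (k : fieldType) (E E' : connection k) : Prop :=
  exists phi : {linear E -> E'},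
    bijective phi /\ forall v, phi (nabla v) = nabla (phi v).

Definition no_horizontal (k : fieldType) (E : connection k) : Prop :=
  forall v : E, nabla v = 0 -> v = 0.

Section Elementary.
Variables (k : fieldType) (hk : [pchar k] =i pred0) (q : nat) (f : puiseux k q).

Definition elem_nabla (v : puiseux k q) : puiseux k q :=
  pderiv v + lX^-1 *: (f * v).

Lemma elem_nabla_leibniz (h : laurent k) (v : puiseux k q) :
  elem_nabla (h *: v) = h *: elem_nabla v + lderiv h *: v.
Proof.
rewrite /elem_nabla pderivZ // scalerDr -!addrA; congr (_ + _).
by rewrite addrC !pscaleE [f * (_ * _)]mulrCA; congr (_ + _); exact: mulrCA.
Qed.

Lemma lderiv_const (c : k) : lderiv (lconst c) = 0.
Proof.
apply: laurentP => n; rewrite lcoef0 /=.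
by case: eqP => [->|_]; rewrite ?mul0r ?mulr0.
Qed.

Lemma elem_nabla_linear (c : k) (u v : puiseux k q) :
  elem_nabla (lconst c *: u + v) = lconst c *: elem_nabla u + elem_nabla v.
Proof.
have addE : {morph elem_nabla : x y / x + y}.
  by move=> x y; rewrite /elem_nabla pderivD mulrDr scalerDr addrACA.
by rewrite addE elem_nabla_leibniz lderiv_const scale0r addr0.
Qed.

(* E_{f,q} = (K_q, d/dx + x^-1 f). *)
Definition elem_conn : connection k :=
  Connection elem_nabla_linear elem_nabla_leibniz.

End Elementary.

Section Classes.
Variables (k : fieldType) (q : nat).
Implicit Types f g : puiseux k q.

Lemma galois_subproof (eta : k) f : exists N, lbound (fun n : int => eta ^ n * f n) N.
Proof. by have [N fN] := lcoefP f; exists N => n /fN->; rewrite mulr0. Qed.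

(* f(t) |-> f(eta t). *)
Definition galois (eta : k) f : puiseux k q := Laurent (galois_subproof eta f).

(* g - f(eta t) lies in t k[[t]] + (1/q)Z for some q-th root of unity eta. *)
Definition Rrel f g : bool :=
  `[< exists eta : k, exists m : int, eta ^+ ramdeg q = 1 /\
        lbound (g - galois eta f - lconst (m%:~R / (ramdeg q)%:R)) 1 >].

Lemma Rrel_refl : reflexive Rrel.
Proof.
move=> f; apply/asboolP; exists 1, 0; split=> [|n _]; first exact: expr1n.
by rewrite /= exp1rz mul1r subrr mul0r if_same subr0.
Qed.

Lemma Rrel_sym : symmetric Rrel.
Proof.
have sym f g : Rrel f g -> Rrel g f.
  case/asboolP => eta [m [eta1 fg]]; apply/asboolP.
  have eta0 : eta != 0.
    by apply/eqP => e0; move: eta1; rewrite e0 expr0n => /esym/eqP; rewrite oner_eq0.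
  exists eta^-1, (- m); split=> [|n n1]; first by rewrite exprVn eta1 invr1.
  have /= /eqP := fg n n1; rewrite subr_eq0 subr_eq => /eqP->.
  rewrite exprz_inv mulrDr mulrA -expfzDr // addNr expr0z mul1r.
  case: (n =P 0) => [->|_]; last by rewrite !(mulr0, add0r, subr0) subrr.
  by rewrite oppr0 expr0z mul1r mulrNz mulNr; ring.
by move=> f g; apply/idP/idP; exact: sym.
Qed.

Lemma Rrel_trans : transitive Rrel.
Proof.
move=> g f h /asboolP[e [m [e1 fg]]] /asboolP[e' [m' [e'1 gh]]]; apply/asboolP.
exists (e' * e), (m' + m); split=> [|n n1]; first by rewrite exprMn e1 e'1 mulr1.
have /= /eqP := fg n n1; rewrite subr_eq0 subr_eq => /eqP fgE.
have /= /eqP := gh n n1; rewrite subr_eq0 subr_eq => /eqP /= ->.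
rewrite fgE expfzMl.
case: (n =P 0) => [->|_]; last by ring.
by rewrite !expr0z intrD; ring.
Qed.

Canonical Rrel_equiv := EquivRel Rrel Rrel_refl Rrel_sym Rrel_trans.

End Classes.

(* R_q(x), and the class of f in it. *)
Definition Rset (k : fieldType) (q : nat) := {eq_quot (@Rrel k q)}%qT.
Definition Rclass (k : fieldType) (q : nat) (f : puiseux k q) : Rset k q :=
  (\pi_({eq_quot (@Rrel k q)}) f)%qT.

(* f is represented by an element of K_q' when some representative f' equals
   some h in K_q' inside K_(q q'); there, f' becomes f'(t^q') and h becomes
   h(t^q). *)
Definition Rcirc (k : fieldType) (q : nat) : set (Rset k q) :=
  [set f | forall q' : nat, (0 < q' < q)%N ->
     ~ exists (f' : puiseux k q) (h : puiseux k q'),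
         Rclass f' = f /\ ramify q' f' = ramify q h].

(* F(u) = sum_n F_n u^n, meaningful when u has positive order; the series is
   then a finite sum in each degree.  Otherwise the value is irrelevant. *)
Definition lcomp_coef (k : fieldType) (F u : laurent k) (m : int) : k :=
  \sum_(n \in [set: int]) F n * (u ^ n : laurent k) m.

Definition lcomp (k : fieldType) (F u : laurent k) : laurent k :=
  match pselect (exists N, lbound (lcomp_coef F u) N) with
  | left H => Laurent H
  | right _ => 0
  end.

Section Composition.
Variable k : fieldType.
Implicit Types a b F u : laurent k.

Lemma lorder_lead a b (n m : int) :
  lorder a n -> lorder b m -> (a * b) (n + m) != 0.
Proof.
move=> [an abn] [bm bbm].
rewrite -[X in X != 0]/(conv a b (n + m)) (@conv_sumE _ _ _ n m _ 1) //; last by lia.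
rewrite big_ord1 addr0 (_ : n + m - n - _ = m); last by rewrite /=; lia.
by rewrite mulf_neq0.
Qed.

Lemma lorder_neq0 a (n : int) : lorder a n -> a != 0.
Proof. by case=> an _; apply: contraNneq an => ->; rewrite lcoef0. Qed.

Lemma lboundV a (n : int) : lorder a n -> lbound (a^-1)%R (- n).
Proof.
move=> an; have a0 := lorder_neq0 an.
have [|m am] := @lorder_exists k a^-1; first by rewrite invr_eq0.
have := lorder_lead an am; rewrite mulfV // lcoef1.
case: (n + m =P 0) => [nm _|_]; last by rewrite eqxx.
by case: am => _; rewrite (_ : - n = m) //; lia.
Qed.

Lemma lboundX a (n : int) (i : nat) : lbound a n -> lbound (a ^+ i)%R (i%:Z * n).
Proof.
move=> an; elim: i => [|i IH].
  by move=> j j0; rewrite expr0 lcoef1; case: eqP => // j0'; lia.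
by rewrite exprS (_ : _ * n = n + i%:Z * n) ?mulrSl //; [exact: lboundM|lia].
Qed.

Lemma lboundXz u (d n : int) : lorder u d -> lbound (u ^ n)%R (n * d).
Proof.
move=> ud; case: n => i; first exact: lboundX ud.2.
rewrite NegzE -exprnN -exprVn mulNr -mulrN; exact: lboundX (lboundV ud).
Qed.

Lemma lcomp_bounded F u (d : int) :
  lorder u d -> 1 <= d -> exists N, lbound (lcomp_coef F u) N.
Proof.
move=> ud d1; have [v Fv] := lcoefP F; exists (Order.min 0 (v * d)) => m.
rewrite lt_min => /andP[m0 mv]; rewrite /lcomp_coef fsbig1 // => n _.
have [/Fv->|vn] := ltP n v; first by rewrite mul0r.
by rewrite (lboundXz ud) ?mulr0 //; nia.
Qed.

Lemma lcompE F u (d N m : int) (L : nat) :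
    lorder u d -> 1 <= d -> lbound F N -> 0 <= N + L%:Z -> m < N + L%:Z ->
  lcomp F u m = \sum_(j < L) F (N + j%:Z) * (u ^ (N + j%:Z) : laurent k) m.
Proof.
move=> ud d1 FN NL0 mNL; rewrite /lcomp; case: pselect; last first.
  by case; exact: lcomp_bounded ud d1.
move=> /= _; rewrite /lcomp_coef.
pose r := [seq N + j%:Z | j <- iota 0 L].
have ur : uniq r by rewrite map_inj_uniq ?iota_uniq // => x y /addrI[].
rewrite -(fsbig_widen [set` r]) //; last first.
  move=> i [_ /= /negP ir].
  have [/FN->|Ni] := ltP i N; first by rewrite mul0r.
  have [Li|iL] := leP (N + L%:Z) i.
    by rewrite (lboundXz ud) ?mulr0 //; nia.
  case/negP: ir; apply/mapP; exists (absz (i - N)%R); last by lia.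
  by rewrite mem_iota; lia.
by rewrite -fsbig_seq // big_map -{1}[L]subn0 big_mkord.
Qed.

End Composition.

(* W is the local Fourier transform F^(0,oo)(E).  The maps phi and psi identify
   W with V = E as k-vector spaces, and [act] is the resulting action of
   k((zeta)) on V.  It extends the operator zeta = - nabla^-1 (which forces
   nabla to be invertible) in the sense of convergent series: it is continuous
   for the zeta-adic topology on k((zeta)) and the z-adic one on V, the latter
   being tested by the k((z))-linear forms on V. *)
Record fourier_0oo_via (k : fieldType) (E W : connection k)
    (phi : E -> W) (psi : W -> E)
    (act := fun (h : laurent k) (v : E) => psi (h *: phi v)) : Prop := {
  fourier_phiK : cancel phi psi;
  fourier_psiK : cancel psi phi;
  fourier_linear : forall (c : k) (u v : E),
    phi (lconst c *: u + v) = lconst c *: phi u + phi v;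
  fourier_zeta_nabla : forall v : E, act lX (nabla v) = - v;
  fourier_nabla_zeta : forall v : E, nabla (act lX v) = - v;
  fourier_continuous :
    forall (v : E) (l : {linear E -> (laurent k)^o}) (N : int),
      exists M : int, forall h : laurent k, lbound h M ->
        lbound (l (act h v) : laurent k) N;
  fourier_connection : forall v : E,
    psi (nabla (phi v)) = - act (lX ^- 2) (lX *: v) }.

Definition fourier_0oo (k : fieldType) (E W : connection k) : Prop :=
  no_horizontal E /\ exists phi psi, @fourier_0oo_via k E W phi psi.

(* u plays the role of z^(1/r) in f = - z zhat, with zhat = zeta^-1 and
   t = zeta^(1/(r+s)). *)
Definition fourier_sol (k : fieldType) (r s : nat)
    (F : puiseux k r) (u : puiseux k (r + s)) : Prop :=
  lorder u 1 /\ lcomp F u = - u ^+ r * (ramify (r + s) lX)^-1.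

(* g = f + s / (2 (r + s)). *)
Definition fourier_g (k : fieldType) (r s : nat)
    (F : puiseux k r) (u : puiseux k (r + s)) : puiseux k (r + s) :=
  lcomp F u + lconst (s%:R / (2 * (r + s))%:R).

(* Main.v *)
Require Import Defs.
From HB Require Import structures.
From mathcomp Require Import all_boot all_order all_algebra.
From mathcomp Require Import boolp classical_sets functions cardinality fsbigop.
From mathcomp Require Import zify ring.

Set Implicit Arguments.
Unset Strict Implicit.
Unset Printing Implicit Defensive.

Import Order.TTheory GRing.Theory Num.Theory.
Local Open Scope ring_scope.
Local Open Scope classical_set_scope.

(** Write [N = r + s], [z = t^r], [zeta = tau^N]. We look for a k-linear bijection
[T : k((t)) -> k((tau))] with [T nabla = - zeta^-1 T], of the form
[T (t^n) = u^n P_n], where [u(tau)] solves [F(u) = - u^r zeta^-1] and [P_n] is a power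
series in [tau].  This [u] is the critical point of the formal stationary phase
expansion of the Fourier integral, and it makes the leading terms of the
equation for [P_n] cancel: order by order in [tau] the coefficients of [P_n],
as functions of [n], solve [a (f(n - N) - f(n)) = known terms].  For [s > 0] this is
uniquely solvable among polynomial functions of [n] once [P_0] is fixed; for
[s = 0] (hence [r = 1]) a further term makes it a recursion of order one on all
functions of [n].  So the solutions [T] form a line over k((tau)).

Since [- zeta^-1 T z - zeta (d/dzeta) T] satisfies the same equation as [T], it
equals [G T] for a Laurent series [G], i.e. [T] carries the Fourier transform of
[E_F] to [E_G].  Normalizing [P_0 = 1] gives [G = F(u) P_r], and the first nonconstant
coefficient of [P] yields [G = F(u) + s/(2N) + r/N] modulo [tau k[[tau]]]; the
summand [r/N] is removed by a gauge transformation of order [r] in [tau].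

That [g] is not defined over a smaller ramification is shown with a prime [p]
dividing [N / gcd(N, q')] and a [p]-th root of unity [xi]: uniqueness of roots gives
[u(xi tau) = xi u(tau)] modulo [tau^(s+1)], whence [F(xi t) - F(t)] has no polar part. *)

(** * Orders and continuous operators on Laurent series *)

(* [lbound] is also the set of lower bounds in [classical_sets]. *)
Local Notation lbound := Defs.lbound.

Section LaurentOrder.
Variable k : fieldType.
Implicit Types (a b u v : laurent k) (n m M : int).

Lemma lbound0 M : lbound (0 : laurent k) M.
Proof. by move=> n _; rewrite lcoef0. Qed.

Lemma lboundD a b M : lbound a M -> lbound b M -> lbound (a + b) M.
Proof. by move=> aM bM n nM; rewrite lcoefD aM ?bM ?addr0. Qed.

Lemma lboundN a M : lbound a M -> lbound (- a) M.
Proof. by move=> aM n nM; rewrite lcoefN aM ?oppr0. Qed.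

Lemma lboundB a b M : lbound a M -> lbound b M -> lbound (a - b) M.
Proof. by move=> aM bM; apply: lboundD aM (lboundN bM). Qed.

Lemma lbound_mono (x : k) n : lbound (lmono x n) n.
Proof. by move=> i ni; rewrite /= lt_eqF. Qed.

Lemma lbound_const (x : k) : lbound (lconst x) 0.
Proof. exact: lbound_mono. Qed.

Lemma lboundS a M : lbound a M -> a M = 0 -> lbound a (M + 1).
Proof.
move=> aM a0 n nM; have [->//|nM'] := eqVneq n M; apply: aM; lia.
Qed.

Lemma lbound_inf a M : (forall i : nat, lbound a (M + i%:Z)) -> a = 0.
Proof.
move=> aM; apply: laurentP => n; rewrite lcoef0.
by apply: (aM (absz (n - M)).+1); lia.
Qed.

Lemma lbound_theta a M : lbound a M -> lbound (theta a) M.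
Proof. by move=> aM n nM; rewrite /= aM ?mulr0. Qed.

Lemma lcoefM_lead a b n m : lbound a n -> lbound b m -> (a * b) (n + m) = a n * b m.
Proof.
move=> an bm; rewrite -[LHS]/(conv a b (n + m)) (@conv_sumE _ _ _ n m _ 1) //; last lia.
by rewrite big_ord1 addr0; congr (_ * b _); rewrite /=; lia.
Qed.

Lemma lboundMr a b n m : lorder a n -> lbound (a * b) (n + m) -> lbound b m.
Proof.
move=> an abm; have := lboundM (lboundV an) abm.
by rewrite mulKf ?addKr // (lorder_neq0 an).
Qed.

Lemma lconstD (x y : k) : lconst (x + y) = lconst x + lconst y.
Proof. by apply: laurentP => n /=; case: ifP; rewrite ?addr0. Qed.

Lemma lconstN (x : k) : lconst (- x) = - lconst x.
Proof. by apply: laurentP => n /=; case: ifP; rewrite ?oppr0. Qed.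

Lemma lconstM (x y : k) : lconst (x * y) = lconst x * lconst y.
Proof. by rewrite /lconst lmonoM addr0. Qed.

Lemma lconstX (x : k) (n : nat) : lconst x ^+ n = lconst (x ^+ n).
Proof. by elim: n => [|n IH]; rewrite ?expr0 // !exprS IH lconstM. Qed.

Lemma lconst0 : lconst 0 = 0 :> laurent k.
Proof. by []. Qed.

Lemma lconst1 : lconst 1 = 1 :> laurent k.
Proof. by []. Qed.

Lemma lmono_split (x : k) n : lmono x n = lconst x * lmono 1 n.
Proof. by rewrite lmonoM mulr1 add0r. Qed.

Lemma lcoefZ (x : k) a n : (lconst x * a) n = x * a n.
Proof. by rewrite lcoef_monoM subr0. Qed.

Lemma lorder_mono n : lorder (lmono (1 : k) n) n.
Proof. by split; [rewrite /= eqxx oner_neq0|exact: lbound_mono]. Qed.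

Lemma lmono_neq0 n : lmono (1 : k) n != 0.
Proof. exact: lorder_neq0 (lorder_mono n). Qed.

Lemma lmonoV n : (lmono (1 : k) n)^-1 = lmono 1 (- n).
Proof.
apply: (mulfI (lmono_neq0 n)); rewrite mulfV ?lmono_neq0 //.
by rewrite lmonoM mulr1 subrr.
Qed.

Lemma theta_mono (x : k) n : theta (lmono x n) = lconst n%:~R * lmono x n.
Proof.
by apply: laurentP => m; rewrite lcoefZ /=; case: eqP => [->//|_]; rewrite !mulr0.
Qed.

Lemma theta1 : theta 1 = 0 :> laurent k.
Proof. by rewrite -lconst1 theta_mono mul0r. Qed.

Lemma thetaD a b : theta (a + b) = theta a + theta b.
Proof. by apply: laurentP => n; rewrite /= mulrDr. Qed.

Lemma thetaZ (x : k) a : theta (lconst x * a) = lconst x * theta a.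
Proof.
apply: laurentP => n.
by rewrite lcoefZ -[LHS]/(n%:~R * (lconst x * a) n) lcoefZ /= mulrCA.
Qed.

Section Powers.
Variables (u : laurent k) (hu : lorder u 1).

Lemma lboundX1 n : lbound (u ^ n) n.
Proof. by have := @lboundXz _ u 1 n hu; rewrite mulr1. Qed.

Lemma lcoefXz_lead n : (u ^ n : laurent k) n = u 1 ^ n.
Proof.
have u1 : u 1 != 0 by case: hu.
have un0 : u != 0 := lorder_neq0 hu.
have nat_case (i : nat) : (u ^ i%:Z : laurent k) i%:Z = u 1 ^ i%:Z.
  elim: i => [|i IH]; first by rewrite !expr0z lcoef1.
  have -> : i.+1%:Z = 1 + i%:Z by lia.
  rewrite expfzDr // expr1z lcoefM_lead ?IH; [|by case: hu|exact: lboundX1].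
  by rewrite expfzDr // expr1z.
case: n => [i|i]; first exact: nat_case.
rewrite NegzE; set j := i.+1.
have := lcoefM_lead (@lboundX1 j%:Z) (@lboundX1 (- j%:Z)).
rewrite -expfzDr // subrr expr0z lcoef1 eqxx nat_case => /esym e.
apply: (mulfI (expfz_neq0 j%:Z u1)).
by rewrite e -expfzDr // subrr expr0z.
Qed.


End Powers.
End LaurentOrder.
Arguments lbound0 {k} M.
Arguments lbound_mono {k} x n.
Arguments lbound_const {k} x.
Arguments lboundX1 {k u} hu n.

(* [filt c A]: A is k-linear and raises t-adic orders by at least c; such an
   operator is continuous, hence determined by its values on monomials. *)
Definition filt (k : fieldType) (c : int) (A : laurent k -> laurent k) : Prop :=
  (forall (x : k) (u v : laurent k), A (lconst x * u + v) = lconst x * A u + A v) /\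
  (forall (v : laurent k) (M : int), lbound v M -> lbound (A v) (M + c)).

Section Filtered.
Variable k : fieldType.
Implicit Types (a u v : laurent k) (c d M : int) (A B : laurent k -> laurent k).

Lemma filt_add c A u v : filt c A -> A (u + v) = A u + A v.
Proof. by case=> lin _; have := lin 1 u v; rewrite !mul1r. Qed.

Lemma filt0 c A : filt c A -> A 0 = 0.
Proof.
by move=> fA; apply: (addIr (A 0)); rewrite -(filt_add _ _ fA) !add0r.
Qed.

Lemma filt_scale c A x v : filt c A -> A (lconst x * v) = lconst x * A v.
Proof. by move=> fA; have := fA.1 x v 0; rewrite (filt0 fA) !addr0. Qed.

Lemma filt_opp c A v : filt c A -> A (- v) = - A v.
Proof. by move=> fA; have := filt_scale (-1) v fA; rewrite lconstN !mulN1r. Qed.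

Lemma filt_sub c A u v : filt c A -> A (u - v) = A u - A v.
Proof. by move=> fA; rewrite (filt_add _ _ fA) (filt_opp _ fA). Qed.

Lemma filt_mono c A x n : filt c A -> A (lmono x n) = lconst x * A (lmono 1 n).
Proof. by move=> fA; rewrite lmono_split (filt_scale _ _ fA). Qed.

Lemma filt_le c d A : d <= c -> filt c A -> filt d A.
Proof.
move=> dc [lin bd]; split=> // v M vM; apply: lbound_le (bd _ _ vM).
by rewrite lerD2l.
Qed.

Lemma filt_id : filt 0 (fun v : laurent k => v).
Proof. by split=> // v M; rewrite addr0. Qed.

Lemma filt_theta c A : filt c A -> filt c (fun v => theta (A v)).
Proof.
move=> fA; split=> [x u v|v M vM]; first by rewrite fA.1 thetaD thetaZ.
exact: lbound_theta (fA.2 _ _ vM).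
Qed.

Lemma filtM c d a A : lbound a d -> filt c A -> filt (d + c) (fun v => a * A v).
Proof.
move=> ad fA; split=> [x u v|v M vM].
  by rewrite fA.1 mulrDr mulrCA.
by have := lboundM ad (fA.2 _ _ vM); rewrite addrCA.
Qed.

Lemma filtD c A B : filt c A -> filt c B -> filt c (fun v => A v + B v).
Proof.
move=> fA fB; split=> [x u v|v M vM].
  by rewrite fA.1 fB.1 mulrDr addrACA.
exact: lboundD (fA.2 _ _ vM) (fB.2 _ _ vM).
Qed.

Lemma filtN c A : filt c A -> filt c (fun v => - A v).
Proof.
move=> fA; split=> [x u v|v M vM]; first by rewrite fA.1 opprD mulrN.
exact: lboundN (fA.2 _ _ vM).
Qed.

Lemma filt_comp c d A B : filt c A -> filt d B -> filt (c + d) (fun v => A (B v)).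
Proof.
move=> fA fB; split=> [x u v|v M vM]; first by rewrite fB.1 fA.1.
by have := fA.2 _ _ (fB.2 _ _ vM); rewrite -addrA [d + c]addrC.
Qed.

(** Everything in [v] beyond its leading monomial is sent to orders above [M + c]. *)
Lemma filt_lead c A v M : filt c A -> lbound v M ->
  A v (M + c) = v M * A (lmono 1 M) (M + c).
Proof.
move=> fA vM; rewrite -{1}(subrK (lmono (v M) M) v) (filt_add _ _ fA).
rewrite lcoefD (filt_mono _ _ fA) lcoefZ (fA.2 _ (M + 1)) ?add0r //; last by lia.
apply: lboundS; first exact: lboundB vM (lbound_mono _ _).
by rewrite lcoefB /= eqxx subrr.
Qed.

(** Leading monomials can be stripped from [v] one at a time without changing [A v], so [A v] has
    arbitrarily high order. *)
Lemma filt_mono_eq0 c A : filt c A -> (forall n, A (lmono 1 n) = 0) ->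
  forall v, A v = 0.
Proof.
move=> fA A0 v; have [M vM] := lcoefP v.
apply: (@lbound_inf _ _ (M + c)) => i.
have [w [wM ->]] : exists w : laurent k, lbound w (M + i%:Z) /\ A v = A w.
  elim: i => [|i [w [wM ->]]]; first by exists v; split=> //; rewrite addr0.
  exists (w - lmono (w (M + i%:Z)) (M + i%:Z)); split.
    have -> : M + i.+1%:Z = M + i%:Z + 1 by lia.
    apply: lboundS; first exact: lboundB wM (lbound_mono _ _).
    by rewrite lcoefB /= eqxx subrr.
  by rewrite (filt_sub _ _ fA) (filt_mono _ _ fA) A0 mulr0 subr0.
by have := fA.2 _ _ wM; rewrite addrAC.
Qed.

Lemma filt_ext c d A B : filt c A -> filt d B ->
  (forall n, A (lmono 1 n) = B (lmono 1 n)) -> A =1 B.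
Proof.
move=> fA fB AB v; apply/eqP; rewrite -subr_eq0; apply/eqP.
have lec : Order.min c d <= c by rewrite ge_min lexx.
have led : Order.min c d <= d by rewrite ge_min lexx orbT.
apply: (filt_mono_eq0 (filtD (filt_le lec fA) (filtN (filt_le led fB)))) => n.
by rewrite AB subrr.
Qed.

Definition lser_coef (q : int -> laurent k) v (m : int) : k :=
  \sum_(n \in [set: int]) v n * q n m.

(* Meaningful when q_n has order at least n + c for a fixed c. *)
Definition lser (q : int -> laurent k) v : laurent k :=
  match pselect (exists N, lbound (lser_coef q v) N) with
  | left H => Laurent H
  | right _ => 0
  end.

Lemma lcomp_lser F u : lcomp F u = lser (fun n => u ^ n) F.
Proof. by []. Qed.

Section Series.
Variables (q : int -> laurent k) (c : int).
Hypothesis hq : forall n, lbound (q n) (n + c).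

Lemma lser_bounded v : exists N, lbound (lser_coef q v) N.
Proof.
have [M vM] := lcoefP v; exists (M + c) => m mM; rewrite /lser_coef fsbig1 // => n _.
have [/vM->|Mn] := ltP n M; first by rewrite mul0r.
by rewrite hq ?mulr0 //; lia.
Qed.

Lemma lserE v (N m : int) (L : nat) : lbound v N -> m < N + L%:Z + c ->
  lser q v m = \sum_(j < L) v (N + j%:Z) * q (N + j%:Z) m.
Proof.
move=> vN mNL; rewrite /lser; case: pselect => [/= _|]; last first.
  by case; exact: lser_bounded.
rewrite /lser_coef.
pose r := [seq N + j%:Z | j <- iota 0 L].
have ur : uniq r by rewrite map_inj_uniq ?iota_uniq // => x y /addrI[].
rewrite -(fsbig_widen [set` r]) //; last first.
  move=> i [_ /= /negP ir].
  have [/vN->|Ni] := ltP i N; first by rewrite mul0r.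
  have [Li|iL] := leP (N + L%:Z) i; first by rewrite hq ?mulr0 //; lia.
  case/negP: ir; apply/mapP; exists (absz (i - N)%R); last by lia.
  by rewrite mem_iota; lia.
by rewrite -fsbig_seq // big_map -{1}[L]subn0 big_mkord.
Qed.

Lemma lser_filt : filt c (lser q).
Proof.
split=> [x u v|v M vM m mM]; last by rewrite (@lserE v M m 0) ?big_ord0 ?addr0.
apply: laurentP => m; rewrite lcoefD lcoefZ.
have [[N0 uN0] [M0 vM0]] := (lcoefP u, lcoefP v).
pose N := Order.min N0 M0.
have uN : lbound u N by apply: lbound_le uN0; rewrite ge_min lexx.
have vN : lbound v N by apply: lbound_le vM0; rewrite ge_min lexx orbT.
pose L := (absz (m - N - c)%R).+1; have mL : m < N + L%:Z + c by rewrite /L; lia.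
rewrite (lserE uN mL) (lserE vN mL) (lserE _ mL); last first.
  apply: lboundD vN; rewrite -[N]add0r.
  exact: lboundM (lbound_const _) uN.
rewrite mulr_sumr -big_split; apply: eq_bigr => j _.
by rewrite lcoefD lcoefZ /=; ring.
Qed.

Lemma lser_mono n : lser q (lmono 1 n) = q n.
Proof.
apply: laurentP => m; have [mn|mn] := ltP m (n + c).
  by rewrite hq // (lser_filt.2 _ _ (lbound_mono _ _)).
pose L := (absz (m - n - c)%R).+1; have mL : m < n + L%:Z + c by rewrite /L; lia.
rewrite (lserE (lbound_mono 1 n) mL) big_ord_recl /= addr0 eqxx mul1r.
rewrite big1 ?addr0 // => j _; rewrite ifF ?mul0r //.
by apply/negbTE; rewrite /bump /=; lia.
Qed.

End Series.

End Filtered.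

(** Course-of-values recursion: [step i] receives the values found so far, padded by [a0]. It serves
    the coefficient-by-coefficient constructions, where a partial sequence is read as a truncated
    series. *)
Lemma causal_rec (A : Type) (a0 : A) (step : nat -> (nat -> A) -> A) :
  exists x : nat -> A,
    forall i, x i = step i (fun l => if (l < i)%N then x l else a0).
Proof.
pose next i (y : nat -> A) l := if (l < i)%N then y l else
  if l == i then step i y else a0.
pose y i := iteri i next (fun _ => a0).
have yE l : y l.+1 l = step l (y l) by rewrite /y /= {1}/next ltnn eqxx.
exists (fun i => y i.+1 i) => i; rewrite yE; congr step; apply/funext => l.
elim: i => [//|i IH]; rewrite -[LHS]/(next i (y i) l) /next.
have [->|ne] := eqVneq l i; first by rewrite ltnn ltnSn yE.
by rewrite IH ltnS [(l <= i)%N]leq_eqVlt (negPf ne) /=; case: (l < i)%N.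
Qed.

(** * Symbols *)

(** The closure properties that keep the coefficients of the symbol equation, as functions of [n],
    inside [S]. The class is that of polynomial functions for [s > 0] and that of all functions for
    [s = 0]. *)
Record coef_class (k : fieldType) (S : (int -> k) -> Prop) : Prop := {
  coef_class0 : S (fun=> 0);
  coef_classD : forall f g, S f -> S g -> S (fun n => f n + g n);
  coef_classZ : forall x f, S f -> S (fun n => x * f n);
  coef_class_shift : forall f (a : int), S f -> S (fun n => f (n + a));
  coef_classM : forall f, S f -> S (fun n => n%:~R * f n) }.

Section SymbolClass.
Variables (k : fieldType) (S : (int -> k) -> Prop) (hS : coef_class S).
Implicit Types (Q P : int -> laurent k) (M m n : int) (f : int -> k).

Definition symbol M Q : Prop :=
  (forall n, lbound (Q n) M) /\ (forall m, S (fun n => Q n m)).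

Lemma symbol_shift M Q (a : int) : symbol M Q -> symbol M (fun n => Q (n + a)).
Proof.
case=> QM QS; split=> // m.
exact: (coef_class_shift hS (f := fun n => Q n m)).
Qed.

Lemma symbolD M Q Q' : symbol M Q -> symbol M Q' -> symbol M (fun n => Q n + Q' n).
Proof.
move=> [QM QS] [Q'M Q'S]; split=> [n|m]; first exact: lboundD.
exact: (coef_classD hS (QS m) (Q'S m)).
Qed.

Lemma symbolMz M Q : symbol M Q -> symbol M (fun n => lconst n%:~R * Q n).
Proof.
case=> QM QS; split=> [n|m].
  by rewrite -[M]add0r; apply: lboundM (lbound_const _) _.
under eq_fun do rewrite lcoefZ.
exact: (coef_classM hS (QS m)).
Qed.

Lemma symbol_theta M Q : symbol M Q -> symbol M (fun n => theta (Q n)).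
Proof.
case=> QM QS; split=> [n|m]; first exact: lbound_theta.
exact: (coef_classZ hS _ (QS m)).
Qed.

Lemma coef_class_sum (I : Type) (l : seq I) (f : I -> int -> k) :
  (forall i, S (f i)) -> S (fun n => \sum_(i <- l) f i n).
Proof.
move=> fS; elim: l => [|i l IH].
  by under eq_fun do rewrite big_nil; exact: coef_class0.
by under eq_fun do rewrite big_cons; apply: coef_classD.
Qed.

Lemma symbolM M Q (a : laurent k) d :
  lbound a d -> symbol M Q -> symbol (d + M) (fun n => a * Q n).
Proof.
move=> ad [QM QS]; split=> [n|m]; first exact: lboundM.
pose L := (absz (m - d - M)%R).+1; have mL : m - d - M < L%:Z by rewrite /L; lia.
rewrite (_ : (fun n => _) =
    fun n => \sum_(j < L) a (d + j%:Z) * Q n (m - d - j%:Z)); last first.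
  by apply/funext => n; rewrite -[LHS]/(conv a (Q n) m) (conv_sumE ad (QM n) mL).
by apply: coef_class_sum => j; apply: (coef_classZ hS); apply: QS.
Qed.

Lemma symbolB M Q Q' : symbol M Q -> symbol M Q' -> symbol M (fun n => Q n - Q' n).
Proof.
move=> hQ hQ'; under eq_fun do rewrite -mulN1r; apply: symbolD => //.
rewrite -[M]add0r; apply: symbolM hQ'; rewrite -lconst1 -lconstN.
exact: lbound_const.
Qed.

Lemma symbol_le M M' Q : M' <= M -> symbol M Q -> symbol M' Q.
Proof. by move=> MM' [QM QS]; split=> // n; apply: lbound_le (QM n). Qed.

Lemma symbol_series_subproof (y : nat -> int -> k) n :
  exists M, lbound (fun m : int => if m < 0 then 0 else y (absz m) n) M.
Proof. by exists 0 => m m0; rewrite m0. Qed.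
Definition symbol_series y n : laurent k := Laurent (symbol_series_subproof y n).

Lemma symbol_series_lbound y n : lbound (symbol_series y n) 0.
Proof. by move=> m m0; rewrite /= m0. Qed.

Lemma symbol_seriesP y : (forall i, S (y i)) -> symbol 0 (symbol_series y).
Proof.
move=> yS; split=> [n|m]; first exact: symbol_series_lbound.
by case m0: (m < 0); rewrite /= m0; [exact: (coef_class0 hS)|exact: yS].
Qed.

End SymbolClass.

(** * The symbol equation and its solution order by order *)

Section Symbols.
Variables (k : fieldType) (r s : nat) (F u : laurent k).
Hypotheses (hF : lorder F (- s%:Z)) (hu : lorder u 1).
Implicit Types (Q P : int -> laurent k) (M m n : int) (f : int -> k).

(* If F(u) = - u^r tau^-(r+s) and phi (t^n) = u^n Q(n) for a k-linear phi, then
   phi \o nabla + tau^-(r+s) phi maps t^n to u^(n-r) [symbol_eq Q n]. *)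
Definition symbol_eq Q n : laurent k :=
  lconst (n%:~R / r%:R) * Q (n - r%:Z) +
  lser (fun j => u ^ j * (Q (n - r%:Z + j) - Q n)) F.

Lemma symbol_weight_bound Q M n : (forall i, lbound (Q i) M) ->
  forall j, lbound (u ^ j * (Q (n - r%:Z + j) - Q n)) (j + M).
Proof.
move=> QM j; apply: lboundM; first exact: (lboundX1 hu).
exact: lboundB (QM _) (QM _).
Qed.

(** For fixed symbols both series are filtered operators applied to [F], so it suffices to compare
    their values on monomials. *)
Lemma symbol_eq_sub Q Q' (a : laurent k) M n :
    (forall i, lbound (Q i) M) -> (forall i, lbound (Q' i) M) ->
  symbol_eq (fun i => Q i - a * Q' i) n = symbol_eq Q n - a * symbol_eq Q' n.
Proof.
move=> QM Q'M; have [d ad] := lcoefP a.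
have fQ := lser_filt (symbol_weight_bound n QM).
have fQ' := lser_filt (symbol_weight_bound n Q'M).
have faQ' := filtN (filtM ad fQ').
pose c := Order.min M (d + M).
have Mc : c <= M by rewrite ge_min lexx.
have dMc : c <= d + M by rewrite ge_min lexx orbT.
have QQ'c i : lbound (Q i - a * Q' i) c.
  apply: lboundB; first exact: lbound_le (QM i).
  by apply: lbound_le dMc _; apply: lboundM.
have fQQ' := lser_filt (symbol_weight_bound n QQ'c).
rewrite /symbol_eq (filt_ext fQQ' (filtD (filt_le Mc fQ) (filt_le dMc faQ'))).
  by ring.
move=> j; rewrite (lser_mono (symbol_weight_bound n QQ'c)).
rewrite (lser_mono (symbol_weight_bound n QM)).
by rewrite (lser_mono (symbol_weight_bound n Q'M)); ring.
Qed.

Let N := (r + s)%N.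
Let a0 : k := F (- s%:Z) * u 1 ^ (- s%:Z).

(** The lowest-order coefficient of [symbol_eq], with [a0] the leading coefficient of F(u). The term
    with [n / r] sits [s] orders above the difference term, so it enters only for [s = 0]. *)
Definition lead_op f n : k :=
  a0 * (f (n - N%:Z) - f n) + (s == 0)%:R * (n%:~R / r%:R * f (n - r%:Z)).

Lemma symbol_eq_lbound Q M n :
  (forall i, lbound (Q i) M) -> lbound (symbol_eq Q n) (M - s%:Z).
Proof.
move=> QM; apply: lboundD.
  apply: lbound_le (lboundM (lbound_const _) (QM _)); lia.
have := (lser_filt (symbol_weight_bound n QM)).2 _ _ hF.2.
by rewrite [- _ + M]addrC.
Qed.

Lemma symbol_eq_lead Q M n : (forall i, lbound (Q i) M) ->
  symbol_eq Q n (M - s%:Z) = lead_op (fun i => Q i M) n.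
Proof.
move=> QM; rewrite lcoefD lcoefZ addrC [M - _]addrC.
rewrite (filt_lead (lser_filt (symbol_weight_bound n QM)) hF.2).
rewrite (lser_mono (symbol_weight_bound n QM)) /lead_op; congr (_ + _).
  rewrite (lcoefM_lead (lboundX1 hu _)); last exact: lboundB.
  rewrite (lcoefXz_lead hu) lcoefB mulrA /a0; congr (_ * (Q _ _ - _)).
  by rewrite /N; lia.
case: eqP => [->|s0]; first by rewrite oppr0 add0r mul1r.
by rewrite mul0r QM ?mulr0 //; lia.
Qed.

Variables (S : (int -> k) -> Prop) (P0 : int -> k).
Hypotheses (hS : coef_class S).
Hypotheses
  (lead_surj : forall b, S b -> exists f, S f /\ lead_op f =1 b)
  (lead_ker : forall f, S f -> lead_op f =1 (fun=> 0) -> forall n, f n = f 0 * P0 n)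
  (SP0 : S P0) (lead_P0 : lead_op P0 =1 (fun=> 0)) (P00 : P0 0 = 1).

(** In a fixed degree [m] only finitely many coefficients of [F] contribute, so closure of [S] under
    finite sums suffices. *)
Lemma coef_class_symbol_eq M Q m :
  symbol S M Q -> S (fun n => symbol_eq Q n m).
Proof.
move=> hQ; have [QM _] := hQ.
apply: (coef_classD hS); last first.
  pose L := (absz (m + s%:Z - M)%R).+1.
  have mL : m < - s%:Z + L%:Z + M by rewrite /L; lia.
  rewrite (_ : (fun n => _) = fun n => \sum_(j < L) F (- s%:Z + j%:Z) *
    (u ^ (- s%:Z + j%:Z) * (Q (n - r%:Z + (- s%:Z + j%:Z)) - Q n) : laurent k) m).
    apply: (coef_class_sum hS) => j; apply: (coef_classZ hS).
    have hQQ : symbol S M (fun n => Q (n - r%:Z + (- s%:Z + j%:Z)) - Q n).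
      apply: (symbolB hS _ hQ); under eq_fun do rewrite -addrA.
      exact: (symbol_shift hS _ hQ).
    exact: (symbolM hS (lboundX1 hu (- s%:Z + j%:Z)) hQQ).2.
  by apply/funext => n; rewrite (lserE (symbol_weight_bound n QM) hF.2 mL).
rewrite (_ : (fun n => _) = fun n => r%:R^-1 *
    ((n%:~R * Q (n - r%:Z) m))); last by apply/funext => n; rewrite lcoefZ; ring.
apply: (coef_classZ hS); apply: (coef_classM hS).
exact: (symbol_shift hS _ hQ).2.
Qed.

(** At each order the lowest coefficient lies in the kernel of [lead_op], hence is a multiple of
    [P0]; its vanishing at [n = 0] kills it, and the order goes up. *)
Lemma symbol_eq0 M Q : symbol S M Q -> (forall n, symbol_eq Q n = 0) ->
  Q 0 = 0 -> forall n, Q n = 0.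
Proof.
move=> [QM QS] Qeq Q0 n; apply: (@lbound_inf _ _ M) => i.
elim: i n => [|i IH] n; first by rewrite addr0.
rewrite -addn1 PoszD addrA; apply: lboundS => //.
rewrite (@lead_ker (fun n => Q n (M + i%:Z)) (QS _)) ?Q0 ?lcoef0 ?mul0r // => j.
by rewrite -symbol_eq_lead // Qeq lcoef0.
Qed.

Theorem symbol_exists : exists P, [/\ symbol S 0 P, forall n, symbol_eq P n = 0,
  P 0 = 1 & forall n, P n 0 = P0 n].
Proof.
(* [R] is a right inverse of [lead_op] on [S], made to vanish at 0 by subtracting a multiple of
   [P0]. Hence only the coefficient of order 0 contributes to [P 0]. *)
have [R RP] : exists R : (int -> k) -> (int -> k), forall b, S b ->
    [/\ S (R b), lead_op (R b) =1 b & R b 0 = 0].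
  suff /choice[R RP] : forall b, exists f : int -> k, S b ->
      [/\ S f, lead_op f =1 b & f 0 = 0] by exists R.
  move=> b; have [Sb|nSb] := pselect (S b); last by exists b.
  have [f [Sf fb]] := lead_surj Sb.
  exists (fun n => f n + - f 0 * P0 n) => _; split=> [|n|].
  - by apply: (coef_classD hS) => //; apply: (coef_classZ hS).
  - have := lead_P0 n; rewrite -fb /lead_op => P0n.
    transitivity (lead_op f n - f 0 * 0); last by rewrite mulr0 subr0.
    by rewrite -P0n /lead_op; ring.
  - by rewrite P00; ring.
pose step i (y : nat -> int -> k) : int -> k := if i is 0 then P0 else
  R (fun n => - symbol_eq (symbol_series y) n (i%:Z - s%:Z)).
have [x xE] := causal_rec (fun=> 0) step.
pose tr i l : int -> k := if (l < i)%N then x l else fun=> 0.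
have Str i : (forall l, (l < i)%N -> S (x l)) -> forall l, S (tr i l).
  by move=> xS l; rewrite /tr; case: ifP => [/xS//|_]; exact: (coef_class0 hS).
have Srhs i : (forall l, S (tr i l)) ->
    S (fun n => - symbol_eq (symbol_series (tr i)) n (i%:Z - s%:Z)).
  move/(symbol_seriesP hS)/coef_class_symbol_eq => /(_ (i%:Z - s%:Z)) /(coef_classZ hS (-1)).
  by under eq_fun do rewrite mulN1r.
have xS i : S (x i).
  elim/ltn_ind: i => i IH; rewrite xE /step; case: i IH => // i IH.
  by have [] := RP _ (Srhs _ (Str _ IH)).
pose P := symbol_series x; have P_symb : symbol S 0 P := symbol_seriesP hS xS.
exists P; split=> // [n||n]; last by rewrite /P /= xE.
- apply: (@lbound_inf _ _ (- s%:Z)) => i.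
  elim: i => [|i IH].
    by rewrite addr0 -[- _]add0r; apply/symbol_eq_lbound/symbol_series_lbound.
  rewrite -addn1 PoszD addrA; apply: (lboundS IH).
  rewrite (_ : - s%:Z + i%:Z = i%:Z - s%:Z); last by rewrite addrC.
  pose T := symbol_series (tr i).
  (* [D] starts at order [i] with coefficient [x i]. So the residual of [P] at order [i - s] is that
     of the truncation [T] plus [lead_op] of [x i], and [step] was chosen to make the two cancel. *)
  pose D n := P n - 1 * T n.
  have Dlb j : lbound (D j) i%:Z.
    move=> m mi; rewrite /D mul1r /P /T lcoefB /= /tr.
    by case: ltP => m0; rewrite ?subr0 // ifT ?subrr //; lia.
  have Di j : D j i%:Z = x i j.
    by rewrite /D mul1r /P /T lcoefB /= /tr ltnn subr0.
  have := symbol_eq_sub 1 n (symbol_series_lbound x) (symbol_series_lbound (tr i)).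
  move=> /(congr1 (fun a : laurent k => a (i%:Z - s%:Z))).
  rewrite lcoefB mul1r (symbol_eq_lead n Dlb).
  rewrite (_ : (fun i0 => _) = x i); last by apply/funext => j; exact: Di.
  move=> /eqP; rewrite eq_sym subr_eq => /eqP ->.
  have := xS i; rewrite {2}xE /step -/(tr i); case: i @T @D Dlb Di {IH}=> [|i] T D Dlb Di _.
    (* For [i = 0] the truncation is zero, and [P0] is in the kernel. *)
    rewrite lead_P0 add0r.
    have -> : tr 0%N = fun=> fun=> 0 by apply/funext.
    have -> : symbol_series (fun=> fun=> 0) = (fun=> 0 : laurent k).
      by apply/funext => j; apply: laurentP => m; rewrite lcoef0 /= if_same.
    have := @symbol_eq_sub (fun=> 0) (fun=> 0) 1 0 n.
    rewrite mul1r !subrr => ->; [by rewrite mul1r subrr lcoef0|by move=> _; exact: lbound0..].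
  have Sr := Srhs i.+1 (Str _ (fun l _ => xS l)).
  by have [_ -> _] := RP _ Sr; rewrite addNr.
- apply: laurentP => m; rewrite lcoef1 /=; case: ltP => m0; first by rewrite lt_eqF.
  rewrite xE; case: (absz m) (gez0_abs m0) => [<-|i <-] /=; first by rewrite P00.
  by have [] := RP _ (Srhs _ (Str i.+1 (fun l _ => xS l))).
Qed.

(** The equation is linear over k((tau)), so Q - Q(0) P solves it too, and it vanishes at
    [n = 0]. *)
Lemma symbol_unique M P Q : symbol S 0 P -> (forall n, symbol_eq P n = 0) -> P 0 = 1 ->
  symbol S M Q -> (forall n, symbol_eq Q n = 0) -> forall n, Q n = Q 0 * P n.
Proof.
move=> hP Peq P_0 hQ Qeq n; apply/eqP; rewrite -subr_eq0; apply/eqP.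
have [d Q0d] := lcoefP (Q 0).
pose c := Order.min 0 (Order.min M d).
have [c0 cM cd] : [/\ c <= 0, c <= M & c <= d].
  by rewrite /c !ge_min !lexx !orbT.
apply: (@symbol_eq0 c (fun n => Q n - Q 0 * P n)) => [|j|].
- apply: (symbolB hS); first exact: symbol_le hQ.
  by apply: symbol_le cd _; rewrite -[d]addr0; apply: (symbolM hS).
- rewrite (@symbol_eq_sub _ _ _ c).
  + by rewrite Qeq Peq mulr0 subrr.
  + by move=> i; apply: lbound_le (hQ.1 i).
  + by move=> i; apply: lbound_le (hP.1 i).
- by rewrite P_0 mulr1 subrr.
Qed.

End Symbols.

(** * The transform attached to a symbol *)

Lemma theta_exprz (k : fieldType) (u : laurent k) (n : int) : u != 0 ->
  theta (u ^ n) = lconst n%:~R * (theta u / u) * u ^ n.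
Proof.
move=> u0.
have step j : theta (u ^ (j + 1)) = theta (u ^ j) * u + u ^ j * theta u.
  by rewrite expfzDr // expr1z thetaM.
have lconstS j : lconst (j + 1)%:~R = lconst j%:~R + 1 :> laurent k.
  by rewrite intrD lconstD.
elim/int_ind: n => [|n IH|n IH]; first by rewrite expr0z theta1 lconst0 !mul0r.
- rewrite (_ : n.+1%:Z = n%:Z + 1) ?step; last by lia.
  by rewrite IH lconstS expfzDr // expr1z; field.
- set j := - n.+1%:Z; have nj : - n%:Z = j + 1 by rewrite /j; lia.
  move: IH; rewrite nj step lconstS expfzDr // expr1z => IH.
  apply: (mulIf u0); apply: (addIr (u ^ j * theta u)).
  by rewrite IH; field.
Qed.

Section Transform.
Variables (k : fieldType) (hk : [pchar k] =i pred0) (r s : nat) (r_gt0 : (0 < r)%N).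
Variables (F u : laurent k).
Hypotheses (hF : lorder F (- s%:Z)) (hu : lorder u 1).
Let N := (r + s)%N.
Hypothesis hFu : lcomp F u = - u ^+ r * lmono 1 (- N%:Z).
Implicit Types (v : laurent k) (c n : int).

(* d/dz + z^-1 F on k((t)), where z = t^r. *)
Definition nabla_t v : laurent k :=
  lmono 1 (- r%:Z) * (lconst r%:R^-1 * theta v + F * v).

Let u0 : u != 0 := lorder_neq0 hu.

Let r0 : r%:R != 0 :> k.
Proof. by move/pcharf0P: hk => ->; rewrite -lt0n. Qed.

Let N0 : N%:R != 0 :> k.
Proof. by move/pcharf0P: hk => ->; rewrite addn_eq0 negb_and -lt0n r_gt0. Qed.

Lemma filt_nabla_t : filt (- N%:Z) nabla_t.
Proof.
have Fs : lbound F (- s%:Z) := hF.2.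
have f1 : filt (0 + 0) (fun v => lconst r%:R^-1 * theta v).
  exact: filtM (lbound_const _) (filt_theta (@filt_id k)).
have f2 : filt (- s%:Z + 0) (fun v => F * v) := filtM Fs (@filt_id k).
have s0 : - s%:Z + 0 <= 0 + 0 by lia.
apply: filt_le (filtM (lbound_mono 1 (- r%:Z)) (filtD (filt_le s0 f1) f2)).
by rewrite /N; lia.
Qed.

(** The commutation relation [d/dz, z] = 1, with z = t^r. *)
Lemma nabla_t_z v : nabla_t (lmono 1 r%:Z * v) = lmono 1 r%:Z * nabla_t v + v.
Proof.
have z1 : lmono 1 (- r%:Z) * lmono 1 r%:Z = 1 :> laurent k.
  by rewrite lmonoM mulr1 addNr.
have rr : lconst r%:R^-1 * lconst r%:R = 1 :> laurent k.
  by rewrite -lconstM mulVf.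
rewrite /nabla_t thetaM theta_mono.
transitivity (lmono 1 (- r%:Z) * lmono 1 r%:Z *
  ((lconst r%:R^-1 * lconst r%:R) * v + (lconst r%:R^-1 * theta v + F * v))).
  by ring.
by rewrite rr z1; transitivity ((lmono 1 (- r%:Z) * lmono 1 r%:Z) *
  (lconst r%:R^-1 * theta v + F * v) + v); [rewrite z1; ring|ring].
Qed.

(** This links the symbol equation to the relation between operators. The series is compared, as an
    operator in the argument [F], with a difference of two filtered operators; the second gives
    [Q n] times F(u), which the equation for [u] turns into the term with zeta^-1. *)
Lemma symbol_eqE c (Phi : laurent k -> laurent k) n : filt c Phi ->
  symbol_eq r F u (fun i => u ^ (- i) * Phi (lmono 1 i)) n =
  u ^ (r%:Z - n) * (Phi (nabla_t (lmono 1 n)) + lmono 1 (- N%:Z) * Phi (lmono 1 n)).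
Proof.
move=> fPhi.
pose Q i := u ^ (- i) * Phi (lmono 1 i).
have QM i : lbound (Q i) c.
  rewrite (_ : c = - i + (i + c)); last by ring.
  exact: lboundM (lboundX1 hu _) (fPhi.2 _ _ (lbound_mono _ _)).
have fq := lser_filt (symbol_weight_bound r hu n QM).
have fPhiF : filt (c + (n - r%:Z + 0)) (fun v => Phi (lmono 1 (n - r%:Z) * v)).
  exact: filt_comp fPhi (filtM (lbound_mono _ _) (@filt_id k)).
have fA := filtM (lboundX1 hu (r%:Z - n)) fPhiF.
have uX j : lbound (u ^ j) (j + 0) by rewrite addr0; exact: lboundX1.
have fB := filtN (filtM (QM n) (lser_filt uX)).
pose d := Order.min (r%:Z - n + (c + (n - r%:Z + 0))) (c + 0).
have dA : d <= r%:Z - n + (c + (n - r%:Z + 0)) by rewrite ge_min lexx.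
have dB : d <= c + 0 by rewrite ge_min lexx orbT.
rewrite /symbol_eq (filt_ext fq (filtD (filt_le dA fA) (filt_le dB fB))).
  have -> : nabla_t (lmono 1 n) =
      lconst (n%:~R / r%:R) * lmono 1 (n - r%:Z) + lmono 1 (n - r%:Z) * F.
    rewrite /nabla_t theta_mono /lconst !lmonoM add0r mulr1 mulrDr lmonoM.
    rewrite mul1r add0r [_^-1 * _]mulrC [- _ + n]addrC [F * _]mulrC mulrA lmonoM.
    by rewrite !mulr1 add0r [- _ + n]addrC.
  rewrite -lcomp_lser hFu (filt_add _ _ fPhi) (filt_scale _ _ fPhi) /Q.
  rewrite opprB.
  rewrite (_ : r%:Z - n = r%:Z + - n) // expfzDr // exprnP; ring.
move=> j; rewrite (lser_mono (symbol_weight_bound r hu n QM)) (lser_mono uX).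
rewrite mulrBr [u ^ j * Q n]mulrC lmonoM mulr1; congr (_ - _).
by rewrite /Q mulrA -expfzDr //; congr (u ^ _ * _); ring.
Qed.

Lemma intertwine_symbol_eq c (Phi : laurent k -> laurent k) : filt c Phi ->
  (forall v, Phi (nabla_t v) = - lmono 1 (- N%:Z) * Phi v) ->
  forall n, symbol_eq r F u (fun i => u ^ (- i) * Phi (lmono 1 i)) n = 0.
Proof. by move=> fPhi PhiN n; rewrite (symbol_eqE _ fPhi) PhiN mulNr addNr mulr0. Qed.

Lemma symbol_eq_intertwine c (Phi : laurent k -> laurent k) : filt c Phi ->
  (forall n, symbol_eq r F u (fun i => u ^ (- i) * Phi (lmono 1 i)) n = 0) ->
  forall v, Phi (nabla_t v) = - lmono 1 (- N%:Z) * Phi v.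
Proof.
move=> fPhi Peq; apply: (filt_ext (filt_comp fPhi filt_nabla_t)).
  exact: (filtM (lboundN (lbound_mono 1 (- N%:Z))) fPhi).
move=> n; have /eqP := Peq n; rewrite (symbol_eqE _ fPhi) mulf_eq0.
by rewrite (negPf (expfz_neq0 _ u0)) /= addr_eq0 mulNr => /eqP.
Qed.

Variables (S : (int -> k) -> Prop) (P0 : int -> k) (hS : coef_class S).
Variable P : int -> laurent k.
Hypotheses
  (lead_ker : forall f, S f -> lead_op r s F u f =1 (fun=> 0) ->
     forall n, f n = f 0 * P0 n)
  (hP : symbol S 0 P) (Peq : forall n, symbol_eq r F u P n = 0) (P_0 : P 0 = 1).

Definition transform v : laurent k := lser (fun n => u ^ n * P n) v.

Lemma transform_weight_bound n : lbound (u ^ n * P n) (n + 0).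
Proof. exact: lboundM (lboundX1 hu n) (hP.1 n). Qed.

Lemma filt_transform : filt 0 transform.
Proof. exact: lser_filt transform_weight_bound. Qed.

Lemma transform_mono n : transform (lmono 1 n) = u ^ n * P n.
Proof. exact: lser_mono transform_weight_bound n. Qed.

Lemma transform_nabla v :
  transform (nabla_t v) = - lmono 1 (- N%:Z) * transform v.
Proof.
apply: (symbol_eq_intertwine filt_transform) => n.
rewrite (_ : (fun i => _) = P) //; apply/funext => i.
by rewrite transform_mono mulrA -expfzDr // addNr mul1r.
Qed.

Lemma transform_z v : transform (lmono 1 r%:Z * v) =
  - lmono 1 N%:Z * (lconst N%:R^-1 * theta (transform v) +
                    lcomp F u * P r%:Z * transform v).
Proof.
have fT := filt_transform.
(* Since [theta] divided by [N] is zeta d/dzeta, this is - zeta^-1 T z - zeta (d/dzeta) T. It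
   satisfies the same relation as T: the contribution of [d/dz, z] = 1 cancels that of d/dzeta
   acting on zeta^-1. *)
pose Phi v := - lmono 1 (- N%:Z) * transform (lmono 1 r%:Z * v)
              - lconst N%:R^-1 * theta (transform v).
have zN : lmono 1 (- N%:Z) * lmono 1 N%:Z = 1 :> laurent k.
  by rewrite lmonoM mulr1 addNr.
have NN : lconst N%:R^-1 * lconst N%:R = 1 :> laurent k by rewrite -lconstM mulVf.
have f1 := filtM (lboundN (lbound_mono 1 (- N%:Z)))
  (filt_comp fT (filtM (lbound_mono 1 r%:Z) (@filt_id k))).
have f2 := filtN (filtM (lbound_const N%:R^-1) (filt_theta fT)).
pose c := - s%:Z.
have c1 : c <= - N%:Z + (0 + (r%:Z + 0)) by rewrite /c /N; lia.
have c2 : c <= 0 + 0 by rewrite /c; lia.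
have fPhi : filt c Phi := filtD (filt_le c1 f1) (filt_le c2 f2).
have PhiN w : Phi (nabla_t w) = - lmono 1 (- N%:Z) * Phi w.
  have zE : lmono 1 r%:Z * nabla_t w = nabla_t (lmono 1 r%:Z * w) - w.
    by rewrite nabla_t_z addrK.
  rewrite /Phi zE (filt_sub _ _ fT).
  rewrite (transform_nabla (lmono 1 r%:Z * w)) (transform_nabla w) thetaM.
  have -> : theta (- lmono 1 (- N%:Z)) = lconst N%:R * lmono 1 (- N%:Z) :> laurent k.
    rewrite -[LHS]/(theta (- lmono 1 (- N%:Z))).
    rewrite -mulN1r -lconst1 -lconstN thetaZ theta_mono mulrA -lconstM.
    by rewrite mulN1r rmorphN /= opprK.
  transitivity (- lmono 1 (- N%:Z) * (- lmono 1 (- N%:Z) *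
     transform (lmono 1 r%:Z * w) - lconst N%:R^-1 * theta (transform w)) +
     lmono 1 (- N%:Z) * transform w * (1 - lconst N%:R^-1 * lconst N%:R)).
    by ring.
  by rewrite NN subrr mulr0 addr0.
have Qeq := intertwine_symbol_eq fPhi PhiN.
pose Q n := u ^ (- n) * Phi (lmono 1 n).
(* Differentiating [u ^ n] brings down a factor [n]. The formula shows that [Q] is again a symbol
   with coefficients in [S], so that uniqueness of symbols applies. *)
have QE n : Q n = lcomp F u * P (n + r%:Z) - lconst N%:R^-1 *
    ((theta u / u) * (lconst n%:~R * P n) + theta (P n)).
  rewrite /Q /Phi lmonoM mulr1 !transform_mono thetaM theta_exprz // hFu.
  rewrite [r%:Z + n]addrC expfzDr // -exprnP.
  transitivity (u ^ (- n) * u ^ n * (- u ^+ r * lmono 1 (- N%:Z) * P (n + r%:Z)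
     - lconst N%:R^-1 * ((theta u / u) * (lconst n%:~R * P n) + theta (P n)))).
    by field.
  by rewrite -expfzDr // addNr mul1r.
have [dF Fd] := lcoefP (lcomp F u); have [du ud] := lcoefP (theta u / u).
pose e := Order.min dF (Order.min du 0).
have [edF edu e0] : [/\ e <= dF + 0, e <= 0 + (du + 0) & e <= 0 + 0].
  by rewrite /e !addr0 !add0r !ge_min !lexx !orbT.
have hQ : symbol S e Q.
  rewrite (funext QE); apply: (symbolB hS).
    exact: symbol_le edF (symbolM hS Fd (symbol_shift hS _ hP)).
  under eq_fun do rewrite mulrDr.
  apply: (symbolD hS).
    exact: symbol_le edu (symbolM hS (lbound_const _) (symbolM hS ud (symbolMz hS hP))).
  exact: symbol_le e0 (symbolM hS (lbound_const _) (symbol_theta hS hP)).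
have QGP := symbol_unique hF hu hS lead_ker hP Peq P_0 hQ Qeq.
have Q0 : Q 0 = lcomp F u * P r%:Z.
  by rewrite QE P_0 theta1 add0r lconst0 mul0r mulr0 !addr0 mulr0 subr0.
have [dG Gd] := lcoefP (Q 0).
have PhiG w : Phi w = Q 0 * transform w.
  apply: (filt_ext fPhi (filtM Gd fT)) => n.
  rewrite transform_mono mulrCA -QGP /Q mulrA -expfzDr //.
  by rewrite addrN mul1r.
have : Phi v + lconst N%:R^-1 * theta (transform v) =
   Q 0 * transform v + lconst N%:R^-1 * theta (transform v) by rewrite PhiG.
rewrite Q0 /Phi subrK addrC => <-.
by rewrite mulrA mulrNN [_ N%:Z * _]mulrC zN mul1r.
Qed.

End Transform.

(** * Polynomial differences and existence of the transform *)

Lemma natr_inj_pchar0 (k : fieldType) :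
  [pchar k] =i pred0 -> injective (fun n : nat => n%:R : k).
Proof.
move=> /pcharf0P hk.
have le m n : (m <= n)%N -> m%:R = n%:R :> k -> m = n.
  move=> mn /esym/eqP; rewrite -subr_eq0 -natrB // hk subn_eq0 => nm.
  by apply/eqP; rewrite eqn_leq mn.
by move=> m n; have [mn /(le _ _ mn)|/ltnW nm /esym/(le _ _ nm)] := leqP m n.
Qed.

Section PolynomialDifferences.
Variables (k : fieldType) (hk : [pchar k] =i pred0).

Lemma exp_subC_expand (a : k) (d : nat) : exists w : {poly k}, (size w <= d)%N /\
  ('X - a%:P) ^+ d.+1 = 'X^(d.+1) - (d.+1%:R * a) *: 'X^d + w.
Proof.
elim: d => [|d [w [sw IH]]].
  exists 0; split; first by rewrite size_poly0.
  by rewrite !expr1 mul1r addr0 expr0 alg_polyC.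
exists (w * ('X - a%:P) + (d.+1%:R * a * a) *: 'X^d); split.
  apply: (leq_trans (size_polyD _ _)); rewrite geq_max; apply/andP; split.
    apply: (leq_trans (size_polyMleq _ _)).
    by rewrite size_XsubC /= addn2 /=.
  by apply: (leq_trans (size_scale_leq _ _)); rewrite size_polyXn.
rewrite exprSr IH -!mul_polyC !polyCM !exprS.
have -> : (d.+2%:R : k)%:P = (d.+1%:R)%:P + 1 by rewrite -polyC1 -polyCD -natr1.
by ring.
Qed.

(** Induction on the degree: the difference of X^(m+1) has leading term - (m+1) a X^m, whose
    coefficient is nonzero in characteristic zero; [c] is chosen to remove the top coefficient of
    [p]. *)
Lemma poly_difference_surj (a : k) (p : {poly k}) : a != 0 ->
  exists q : {poly k}, forall x, q.[x - a] - q.[x] = p.[x].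
Proof.
move=> a0; have [m] := ubnP (size p); elim: m p => // m IH p; rewrite ltnS => sp.
have [w [sw wE]] := exp_subC_expand a m.-1.
case: m => [|m] in IH sp w sw wE *.
  by exists 0 => x; move/size_poly_leq0P: sp => ->; rewrite !horner0 subrr.
have ma0 : m.+1%:R * a != 0 by rewrite mulf_neq0 // (pcharf0P k).1.
pose c := - p`_m / (m.+1%:R * a).
have [|q qE] := IH (p - c *: (w - (m.+1%:R * a) *: 'X^m)).
  rewrite ltnS; apply/leq_sizeP => i im.
  rewrite coefB coefZ coefB coefZ coefXn.
  rewrite [w`_i]nth_default; last exact: leq_trans sw im.
  have [->|ne] := eqVneq i m; first by rewrite /c mulr1 sub0r mulrN opprK divfK // addrN.
  rewrite mulr0 subrr mulr0 subr0 nth_default //.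
  by apply: leq_trans sp _; rewrite ltn_neqAle eq_sym ne.
exists (q + c *: 'X^(m.+1)) => x.
have wx : (x - a) ^+ m.+1 = x ^+ m.+1 - m.+1%:R * a * x ^+ m + w.[x].
  have := congr1 (fun p => p.[x]) wE.
  by rewrite !hornerE.
have := qE x; rewrite !hornerE wx => qx.
have -> : q.[x - a] = q.[x] + (p.[x] - c * (w.[x] - m.+1%:R * a * x ^+ m)).
  by rewrite -qx; ring.
by ring.
Qed.

(** In characteristic zero the multiples of [N] are distinct, so p - p(0) has more roots than its
    degree allows. *)
Lemma poly_periodic_const (N : nat) (p : {poly k}) : (0 < N)%N ->
    (forall n : int, p.[(n - N%:Z)%:~R] = p.[n%:~R]) ->
  forall n : int, p.[n%:~R] = p.[0].
Proof.
move=> N0 per n; set q := p - p.[0]%:P.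
suff q0 : q = 0 by apply/eqP; rewrite -subr_eq0 -[p.[0]](hornerC _ n%:~R) -hornerN
  -hornerD -/q q0 horner0.
apply/eqP; apply: contraT => q_neq0.
pose rs := [seq (j * N)%:R : k | j <- iota 0 (size q)].
suff : (size rs < size q)%N by rewrite size_map size_iota ltnn.
apply: max_poly_roots => //.
  apply/allP => _ /mapP[j _ ->]; rewrite rootE hornerD hornerN hornerC subr_eq0.
  apply/eqP; elim: j => [|j IH]; first by rewrite mul0n.
  rewrite -{}IH -[(j * N)%:R]/((j * N)%:Z%:~R) -[(j.+1 * N)%:R]/((j.+1 * N)%:Z%:~R).
  by rewrite -per; congr p.[_%:~R]; lia.
rewrite map_inj_uniq ?iota_uniq // => i j /(natr_inj_pchar0 hk) /eqP.
by rewrite eqn_pmul2r // => /eqP.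
Qed.

Definition poly_fun (f : int -> k) : Prop :=
  exists p : {poly k}, forall n, f n = p.[n%:~R].

Lemma poly_fun_class : coef_class poly_fun.
Proof.
split=> [|f g [p pE] [q qE]|x f [p pE]|f a [p pE]|f [p pE]].
- by exists 0 => n; rewrite horner0.
- by exists (p + q) => n; rewrite hornerD pE qE.
- by exists (x *: p) => n; rewrite hornerZ pE.
- by exists (p \Po ('X + a%:~R%:P)) => n; rewrite horner_comp !hornerE pE intrD.
- by exists ('X * p) => n; rewrite !hornerE pE.
Qed.

End PolynomialDifferences.

(** The right inverses [dn n] of [up n] run the recursion towards negative indices. *)
Lemma int_rec_exists (A : Type) (x0 : A) (up dn : int -> A -> A) :
    (forall n, cancel (dn n) (up n)) ->
  exists f : int -> A, f 0 = x0 /\ forall n, f n = up n (f (n - 1)).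
Proof.
move=> dnK.
pose fp := fix fp (n : nat) := if n is m.+1 then up n%:Z (fp m) else x0.
pose fn := fix fn (n : nat) := if n is m.+1 then dn (- m%:Z) (fn m) else x0.
exists (fun n => match n with Posz m => fp m | Negz m => fn m.+1 end).
split=> // -[[|m]|m].
- by rewrite /= dnK.
- by rewrite (_ : m.+1%:Z - 1 = m%:Z) //; lia.
- have -> : Negz m - 1 = Negz m.+1 by lia.
  by rewrite [fn m.+2]/= NegzE dnK.
Qed.

Section CompositionOrder.
Variables (k : fieldType) (u : laurent k) (hu : lorder u 1).

Lemma lcompX_weight_bound j : lbound (u ^ j) (j + 0).
Proof. by rewrite addr0; exact: lboundX1. Qed.

Lemma lcomp_lbound (G : laurent k) M : lbound G M -> lbound (lcomp G u) M.
Proof. by move/(lser_filt lcompX_weight_bound).2; rewrite addr0. Qed.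

Lemma lcomp_lead (G : laurent k) M : lbound G M -> lcomp G u M = G M * u 1 ^ M.
Proof.
move/(filt_lead (lser_filt lcompX_weight_bound)); rewrite !addr0 => ->.
by rewrite (lser_mono lcompX_weight_bound) lcoefXz_lead.
Qed.

End CompositionOrder.

(** Writing zeta = tau^(r+s), T turns nabla into - zeta^-1 and z into - zeta^2 (d/dzeta + zeta^-1
    G), which is the local Fourier transform with target E_G. The condition on leading terms makes T
    bijective. *)
Definition transform_spec (k : fieldType) (r s : nat) (F G : laurent k) (m : int)
    (T : laurent k -> laurent k) : Prop :=
  [/\ filt m T, forall n, T (lmono 1 n) (n + m) != 0,
      forall v, T (nabla_t r F v) = - lmono 1 (- (r + s)%N%:Z) * T v &
      forall v, T (lmono 1 r%:Z * v) =
        - lmono 1 (r + s)%N%:Z * (lconst (r + s)%:R^-1 * theta (T v) + G * T v)].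

(** * Existence of the transform, for s > 0 and for s = 0 *)

Section TransformExists.
Variables (k : fieldType) (hk : [pchar k] =i pred0) (r s : nat) (r_gt0 : (0 < r)%N).
Variables (F u : laurent k).
Hypotheses (hF : lorder F (- s%:Z)) (hu : lorder u 1).
Let N := (r + s)%N.
Hypothesis hFu : lcomp F u = - u ^+ r * lmono 1 (- N%:Z).

Let a0 : k := F (- s%:Z) * u 1 ^ (- s%:Z).

Let a0_neq0 : a0 != 0.
Proof. by rewrite mulf_neq0 ?expfz_neq0 //; [case: hF|case: hu]. Qed.

Let natr0 n : (n%:R == 0 :> k) = (n == 0)%N.
Proof. by move/pcharf0P: hk. Qed.

Variables (S : (int -> k) -> Prop) (P0 : int -> k) (hS : coef_class S).
Hypotheses
  (lead_surj : forall b, S b -> exists f, S f /\ lead_op r s F u f =1 b)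
  (lead_ker : forall f, S f -> lead_op r s F u f =1 (fun=> 0) ->
     forall n, f n = f 0 * P0 n)
  (SP0 : S P0) (lead_P0 : lead_op r s F u P0 =1 (fun=> 0)) (P00 : P0 0 = 1)
  (P0_neq0 : forall n, P0 n != 0).

(** Here G = F(u) P_r. As F(u) has order -s, a difference P_r - 1 of order at least [s] changes F(u)
    only in degrees at least 0, and its coefficient of degree [s], times [a0], is the change in the
    constant term. *)
Lemma transform_spec_exists :
    (forall P, symbol S 0 P -> (forall n, symbol_eq r F u P n = 0) -> P 0 = 1 ->
       (forall n, P n 0 = P0 n) ->
       lbound (P r%:Z - 1) s%:Z /\
       a0 * (P r%:Z - 1) s%:Z = s%:R / (2 * N)%:R + r%:R / N%:R) ->
  exists G T, transform_spec r s F G 0 T /\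
    lbound (G - lcomp F u - lconst (s%:R / (2 * N)%:R) - lconst (r%:R / N%:R)) 1.
Proof.
move=> P_r; have [P [hP Peq P_0 P_lead]] :=
  symbol_exists hF hu hS lead_surj SP0 lead_P0 P00.
exists (lcomp F u * P r%:Z), (transform u P); split; first split.
- exact: (filt_transform hu hP).
- move=> n; rewrite (transform_mono hu hP).
  rewrite (lcoefM_lead (lboundX1 hu n) (hP.1 n)).
  by rewrite P_lead lcoefXz_lead // mulf_neq0 ?expfz_neq0 //; case: hu.
- exact: (transform_nabla hk r_gt0 hF hu hFu hP Peq).
- exact: (transform_z hk r_gt0 hF hu hFu hS lead_ker hP Peq P_0).
have [Pr Prs] := P_r P hP Peq P_0 P_lead.
have Fu : lbound (lcomp F u) (- s%:Z) := lcomp_lbound hu hF.2.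
rewrite (_ : _ - _ - _ - _ =
  lcomp F u * (P r%:Z - 1) - lconst (s%:R / (2 * N)%:R + r%:R / N%:R)); last first.
  by rewrite lconstD; ring.
rewrite -[X in lbound _ X]add0r; apply: lboundS.
  apply: lboundB; last exact: lbound_const.
  by have := lboundM Fu Pr; rewrite addNr.
have := lcoefM_lead Fu Pr; rewrite addNr => FuP.
by rewrite lcoefB FuP (lcomp_lead hu hF.2) Prs subrr.
Qed.

End TransformExists.

Section TransformCases.
Variables (k : fieldType) (hk : [pchar k] =i pred0) (r s : nat) (r_gt0 : (0 < r)%N).
Variables (F u : laurent k).
Hypotheses (hF : lorder F (- s%:Z)) (hu : lorder u 1).
Let N := (r + s)%N.
Hypothesis hFu : lcomp F u = - u ^+ r * lmono 1 (- N%:Z).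

Let a0 : k := F (- s%:Z) * u 1 ^ (- s%:Z).

Let a0_neq0 : a0 != 0.
Proof. by rewrite mulf_neq0 ?expfz_neq0 //; [case: hF|case: hu]. Qed.

Let natr0 n : (n%:R == 0 :> k) = (n == 0)%N.
Proof. by move/pcharf0P: hk. Qed.

Let N0 : N%:R != 0 :> k.
Proof. by rewrite natr0 addn_eq0 negb_and -lt0n r_gt0. Qed.

Let r0 : r%:R != 0 :> k.
Proof. by rewrite natr0 -lt0n. Qed.

Let two0 : 2%:R != 0 :> k.
Proof. by rewrite natr0. Qed.

(** The constant symbol 1 solves the equation up to [n / r], a term of order 0. So [P - 1] starts at
    order [s], where its coefficient is a quadratic polynomial in [n] that can be computed. *)
Lemma transform_exists_irregular : (0 < s)%N ->
  exists G T, transform_spec r s F G 0 T /\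
    lbound (G - lcomp F u - lconst (s%:R / (2 * N)%:R) - lconst (r%:R / N%:R)) 1.
Proof.
move=> s_gt0.
have leadE f n : lead_op r s F u f n = a0 * (f (n - N%:Z) - f n).
  by rewrite /lead_op (gtn_eqF s_gt0) mul0r addr0.
have cc := poly_fun_class k.
have const_poly (x : k) : poly_fun (fun=> x).
  by exists x%:P => n; rewrite hornerC.
have ker f : poly_fun f -> lead_op r s F u f =1 (fun=> 0) ->
    forall n, f n = f 0 * 1.
  move=> [p pE] f0 n; rewrite mulr1 !pE; apply: (poly_periodic_const hk (N := N)).
    by rewrite addn_gt0 r_gt0.
  move=> m; have /eqP := f0 m; rewrite leadE mulf_eq0 (negPf a0_neq0) /=.
  by rewrite subr_eq0 !pE => /eqP.
apply: (@transform_spec_exists k hk r s r_gt0 F u hF hu hFu (@poly_fun k) (fun=> 1)) => //.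
- move=> b [p pE]; have [q qE] := poly_difference_surj hk (a0^-1 *: p) N0.
  exists (fun n => q.[n%:~R]); split; first by exists q.
  move=> n; rewrite leadE pE.
  have := qE n%:~R; rewrite hornerZ -[N%:R]/(N%:Z%:~R) -intrB => ->.
  by rewrite mulVKf.
- by move=> n; rewrite leadE subrr mulr0.
- by move=> n; exact: oner_neq0.
move=> P hP Peq P_0 _.
have h1 : symbol (@poly_fun k) 0 (fun=> 1).
  split=> [_|m]; first by rewrite -lconst1; exact: lbound_const.
  exact: const_poly.
pose D n := P n - 1 * 1.
have hD : symbol (@poly_fun k) 0 D.
  by rewrite /D mul1r; exact: symbolB.
have eq1 n : symbol_eq r F u (fun=> 1) n = lconst (n%:~R / r%:R).
  rewrite /symbol_eq mulr1 (filt_mono_eq0 (lser_filt (symbol_weight_bound r hu n h1.1))).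
    by rewrite addr0.
  move=> j; rewrite (lser_mono (symbol_weight_bound r hu n h1.1)).
  by rewrite subrr mulr0.
have Deq n : symbol_eq r F u D n = - lconst (n%:~R / r%:R).
  by rewrite (symbol_eq_sub r F hu 1 n hP.1 h1.1) Peq eq1 mul1r sub0r.
have D0 : D 0 = 0 by rewrite /D P_0 mul1r subrr.
have Ds n : lbound (D n) s%:Z.
  suff H i : (i <= s)%N -> forall n, lbound (D n) i%:Z by exact: H.
  elim: i => [_ j|i IH lis j]; first exact: hD.1.
  have {}IH := IH (ltnW lis).
  rewrite -addn1 PoszD; apply: lboundS => //.
  (* The coefficient of order [i] is seen in degree [i - s < 0], where the right-hand side
     vanishes. *)
  rewrite (ker (fun n => D n i%:Z)) ?D0 ?lcoef0 ?mul0r //; first exact: hD.2.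
  move=> m; rewrite -(symbol_eq_lead r hF hu m IH) Deq lcoefN /= ifF ?oppr0 //.
  by apply/negbTE; lia.
pose f n : k := D n s%:Z.
have fE n : lead_op r s F u f n = - (n%:~R / r%:R).
  rewrite -(symbol_eq_lead r hF hu n Ds) Deq lcoefN /= ifT //.
  by rewrite subrr.
(* The quadratic [g] satisfies g(n - N) - g(n) = - 2 A N n and g(0) = 0, and [A] is the factor that
   makes [a0] times this equal to [- n / r]. Then a0 g(r) = (r + N) / (2N), which is s / (2N) + r /
   N. *)
pose A : k := (2%:R * N%:R * r%:R * a0)^-1.
pose g (n : int) : k := A * (n%:~R * n%:~R) + A * N%:R * n%:~R.
have gE n : lead_op r s F u g n = - (n%:~R / r%:R).
  rewrite leadE /g intrB -[N%:Z%:~R]/(N%:R : k) /A.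
  by field; rewrite a0_neq0 r0 N0 two0.
have fg n : f n = g n.
  apply/eqP; rewrite -subr_eq0; apply/eqP.
  have idp : poly_fun (fun n => n%:~R : k).
    by exists 'X => m; rewrite hornerX.
  have gp : poly_fun g.
    apply: (coef_classD cc); apply: (coef_classZ cc) => //.
    exact: (coef_classM cc).
  rewrite (ker (fun n => f n - g n)); first last.
  - move=> m; transitivity (lead_op r s F u f m - lead_op r s F u g m).
      by rewrite !leadE; ring.
    by rewrite fE gE subrr.
  - under eq_fun do rewrite -mulN1r.
    apply: (coef_classD cc); last exact: (coef_classZ cc).
    exact: hD.2.
  by rewrite mulr1 /f D0 lcoef0 /g mulr0z !mulr0 addr0 subrr.
have DP : P r%:Z - 1 = D r%:Z by rewrite /D mul1r.
split; first by rewrite DP; exact: Ds.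
rewrite -/a0 DP -/(f _) fg /g /A -[r%:Z%:~R]/(r%:R : k) natrM.
have sN : s%:R = N%:R - r%:R :> k by rewrite /N natrD addrAC subrr add0r.
by rewrite -/N sN; field; rewrite a0_neq0 r0 N0 two0.
Qed.

(** The leading operator is a recursion of order one, (F_0 + n) f(n - 1) - F_0 f(n). As no [F 0 + n]
    vanishes, it can be run in both directions on all functions of [n]. *)
Lemma transform_exists_regular : s = 0%N -> r = 1%N ->
    (forall n : int, F 0 + n%:~R != 0) ->
  exists G T, transform_spec r s F G 0 T /\
    lbound (G - lcomp F u - lconst (s%:R / (2 * N)%:R) - lconst (r%:R / N%:R)) 1.
Proof.
move=> s0 r1 Fn.
have a0E : a0 = F 0 by rewrite /a0 s0 oppr0 expr0z mulr1.
have leadE f n : lead_op r s F u f n = (F 0 + n%:~R) * f (n - 1) - F 0 * f n.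
  rewrite /lead_op -/a0 a0E s0 r1 eqxx mul1r addn0 divr1; ring.
have F00 : F 0 != 0 by rewrite -a0E.
pose c n := (F 0 + n%:~R) / F 0.
have c0 n : c n != 0 by rewrite mulf_neq0 ?invr_eq0.
(* For n > 0 this is the product of (F_0 + j) / F_0 over 1 <= j <= n, a quotient of Gamma values up
   to a power of F_0. *)
have [P0 [P00 P0E]] := int_rec_exists 1 (fun n => mulVKf (c0 n)).
have P0S n : F 0 * P0 n = (F 0 + n%:~R) * P0 (n - 1).
  by rewrite P0E /c mulrA mulrCA mulfV // mulr1.
have int_step (A : int -> Prop) : A 0 -> (forall n, A n <-> A (n - 1)) -> forall n, A n.
  move=> A0 AS; elim/int_ind => [//|n An|n An].
    by apply/AS; rewrite (_ : n.+1%:Z - 1 = n%:Z) //; lia.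
  by move/AS: An; rewrite (_ : - n%:Z - 1 = - n.+1%:Z) //; lia.
have P0_neq0 : forall n, P0 n != 0.
  apply: int_step => [|n]; first by rewrite P00 oner_neq0.
  by rewrite P0E mulf_eq0 negb_or c0.
have all_class : coef_class (fun _ : int -> k => True) by [].
have ker f : lead_op r s F u f =1 (fun=> 0) -> forall n, f n = f 0 * P0 n.
  move=> f0; apply: int_step => [|n]; first by rewrite P00 mulr1.
  have /eqP := f0 n; rewrite leadE subr_eq0 => /eqP fS.
  split=> [fn|fn].
    by apply: (mulfI (Fn n)); rewrite fS fn mulrCA P0S mulrCA.
  by apply: (mulfI F00); rewrite -fS fn mulrCA -P0S mulrCA.
apply: (@transform_spec_exists k hk r s r_gt0 F u hF hu hFu (fun=> True) P0) => //.
(* Variation of constants: for f = P0 h the equation becomes h(n - 1) - h(n) = d(n). *)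
- move=> b _; pose d n := b n / (F 0 * P0 n).
  have [h [_ hE]] := int_rec_exists 0 (fun n => addrK (d n)).
  exists (fun n => P0 n * h n); split=> // n.
  rewrite leadE mulrA -P0S (hE n) /d.
  by field; rewrite F00 P0_neq0.
- by move=> f _; exact: ker.
- by move=> n; rewrite leadE -P0S subrr.
move=> P hP Peq P_0 Plead; rewrite r1 s0; split.
  by apply: lboundB; [exact: hP.1|rewrite -lconst1; exact: lbound_const].
rewrite mul0r add0r addn0 divr1 lcoefB Plead lcoef1 oppr0 expr0z mulr1 mulrBr.
by rewrite P0S subrr P00 !mulr1 addrC addKr.
Qed.

End TransformCases.

(** * The equation for u *)

Section PowerDifference.
Variables (k : fieldType) (u u' : laurent k) (i : int).
Hypotheses (hu : lorder u 1) (hu' : lorder u' 1) (uu'1 : u' 1 = u 1).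
Hypothesis uu' : lbound (u' - u) (i + 1).

Let u0 : u != 0 := lorder_neq0 hu.
Let u'0 : u' != 0 := lorder_neq0 hu'.
Let u1_neq0 : u 1 != 0. Proof. by case: hu. Qed.

(** First-order Taylor expansion of the j-th power. Positive [j] follow from the step formula; for
    negative [j] the same step is solved backwards, dividing by [u']. *)
Lemma exprz_diff (j : int) : lbound (u' ^ j - u ^ j) (j + i) /\
  (u' ^ j - u ^ j) (j + i) = j%:~R * u 1 ^ (j - 1) * (u' - u) (i + 1).
Proof.
have stepE (m : int) :
    u' ^ (m + 1) - u ^ (m + 1) = (u' ^ m - u ^ m) * u' + u ^ m * (u' - u).
  rewrite (expfzDr _ _ u'0) (expfzDr _ _ u0) (expr1z u) (expr1z u').
  by rewrite mulrBl mulrBr addrA subrK.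
have ordE (m : int) : m + 1 + i = m + (i + 1) by ring.
have leadE (m : int) : (u ^ m * (u' - u)) (m + (i + 1)) = u 1 ^ m * (u' - u) (i + 1).
  by rewrite (lcoefM_lead (lboundX1 hu m) uu') lcoefXz_lead.
have powE (m : int) : u 1 ^ m = u 1 ^ (m - 1) * u 1.
  by rewrite -{3}[u 1]expr1z -expfzDr // subrK.
elim/int_ind: j => [|m [IHb IHc]|m [IHb IHc]].
- rewrite !expr0z subrr mulr0z !mul0r; split; first exact: lbound0.
  exact: lcoef0.
- have -> : m.+1%:Z = m%:Z + 1 by lia.
  have b1 : lbound ((u' ^ m%:Z - u ^ m%:Z) * u') (m%:Z + (i + 1)).
    by have := lboundM IHb hu'.2; rewrite -addrA.
  rewrite stepE ordE; split; first exact: lboundD b1 (lboundM (lboundX1 hu m%:Z) uu').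
  have E := lcoefM_lead IHb hu'.2; rewrite -addrA in E.
  by rewrite [LHS]lcoefD E leadE IHc uu'1 addrK intrD (powE m%:Z); ring.
- set j := - m.+1%:Z; have jE : - m%:Z = j + 1 by rewrite /j; lia.
  rewrite {}jE stepE in IHb IHc.
  have b2 := lboundM (lboundX1 hu j) uu'.
  have b1 : lbound ((u' ^ j - u ^ j) * u') (1 + (j + i)).
    rewrite (_ : 1 + (j + i) = j + 1 + i); last by ring.
    by have := lboundB IHb; rewrite ordE => /(_ _ b2); rewrite addrK.
  have b : lbound (u' ^ j - u ^ j) (j + i) by apply: lboundMr hu' _; rewrite mulrC.
  split=> //; apply: (mulIf u1_neq0).
  have := lcoefM_lead b hu'.2; rewrite uu'1 => <-.
  have -> : j + i + 1 = j + 1 + i by ring.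
  apply: (addIr (u 1 ^ j * (u' - u) (i + 1))).
  rewrite -leadE -ordE -lcoefD IHc addrK intrD (powE j) ordE leadE (powE j).
  by ring.
Qed.

Lemma lcomp_diff (G : laurent k) (M : int) : lbound G M ->
  lbound (lcomp G u' - lcomp G u) (M + i) /\
  (lcomp G u' - lcomp G u) (M + i) = G M * (M%:~R * u 1 ^ (M - 1) * (u' - u) (i + 1)).
Proof.
have w := lcompX_weight_bound hu; have w' := lcompX_weight_bound hu'.
have fd : filt i (fun v => lcomp v u' - lcomp v u).
  have fd0 := filtD (lser_filt w') (filtN (lser_filt w)).
  have wd j : lbound (u' ^ j - u ^ j) (j + i) by have [] := exprz_diff j.
  have E : (fun v => lcomp v u' - lcomp v u) = lser (fun j => u' ^ j - u ^ j).
    apply/funext; apply: (filt_ext fd0 (lser_filt wd)) => n.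
    by rewrite (lser_mono w) (lser_mono w') (lser_mono wd).
  by rewrite E; exact: lser_filt.
move=> GM; split; first exact: fd.2.
rewrite (filt_lead fd GM) !lcomp_lser (lser_mono w) (lser_mono w').
by have [_ ->] := exprz_diff M.
Qed.

End PowerDifference.

(** * The substitution of eta tau for tau *)

Definition twist (k : fieldType) (eta : k) (a : laurent k) : laurent k :=
  @galois k 1 eta a.

Section Twist.
Variables (k : fieldType) (eta : k) (eta0 : eta != 0).
Implicit Types a b u F : laurent k.

Lemma twistE a n : twist eta a n = eta ^ n * a n.
Proof. by []. Qed.

Lemma lbound_twist a M : lbound a M -> lbound (twist eta a) M.
Proof. by move=> aM n nM; rewrite twistE aM ?mulr0. Qed.

Lemma twistD a b : twist eta (a + b) = twist eta a + twist eta b.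
Proof. by apply: laurentP => n; rewrite lcoefD !twistE lcoefD mulrDr. Qed.

Lemma twistN a : twist eta (- a) = - twist eta a.
Proof. by apply: laurentP => n; rewrite lcoefN !twistE lcoefN mulrN. Qed.

Lemma twist_mono x n : twist eta (lmono x n) = lmono (eta ^ n * x) n.
Proof. by apply: laurentP => m; rewrite twistE /=; case: eqP => [->|_]; rewrite ?mulr0. Qed.

Lemma twistM a b : twist eta (a * b) = twist eta a * twist eta b.
Proof.
apply: laurentP => n; have [[N aN] [M bM]] := (lcoefP a, lcoefP b).
pose L := (absz (n - N - M)%R).+1; have nL : n - N - M < L%:Z by rewrite /L; lia.
rewrite twistE -[(a * b) n]/(conv a b n) (conv_sumE aN bM nL).
rewrite -[RHS]/(conv _ _ n) (conv_sumE (lbound_twist aN) (lbound_twist bM) nL).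
rewrite mulr_sumr; apply: eq_bigr => j _; rewrite !twistE mulrACA -expfzDr //.
by congr (eta ^ _ * _); lia.
Qed.

Lemma twist1 : twist eta 1 = 1.
Proof. by rewrite -lconst1 twist_mono expr0z mul1r. Qed.

Lemma twistX a (n : nat) : twist eta (a ^+ n) = twist eta a ^+ n.
Proof. by elim: n => [|n IH]; rewrite ?expr0 ?twist1 // !exprS twistM IH. Qed.

Lemma twistV a : twist eta a^-1 = (twist eta a)^-1.
Proof.
have [->|a0] := eqVneq a 0.
  have t0 : twist eta 0 = 0 by apply: laurentP => n; rewrite twistE !lcoef0 mulr0.
  by rewrite invr0 !t0 invr0.
have aa : twist eta a^-1 * twist eta a = 1 by rewrite -twistM mulVf // twist1.
have ta0 : twist eta a != 0.
  by apply: contra_eq_neq aa => ->; rewrite mulr0 eq_sym oner_neq0.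
by apply: (mulIf ta0); rewrite aa mulVf.
Qed.

Lemma twistXz a (n : int) : twist eta (a ^ n) = twist eta a ^ n.
Proof. by case: n => n; rewrite ?NegzE -?exprnN -?exprnP ?twistV twistX. Qed.

Lemma lorder_twist a n : lorder a n -> lorder (twist eta a) n.
Proof.
by case=> an aM; split; [rewrite twistE mulf_neq0 // expfz_neq0|exact: lbound_twist].
Qed.

Lemma twist_lcomp F u : lorder u 1 -> twist eta (lcomp F u) = lcomp F (twist eta u).
Proof.
move=> hu; have w := lcompX_weight_bound hu.
have w' := lcompX_weight_bound (lorder_twist hu).
have ft : filt 0 (twist eta).
  split=> [x a b|a M aM]; last by rewrite addr0; exact: lbound_twist.
  by rewrite twistD twistM twist_mono expr0z mul1r.
apply: (filt_ext (filt_comp ft (lser_filt w)) (lser_filt w')) => n.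
by rewrite (lser_mono w) (lser_mono w') twistXz.
Qed.

End Twist.

(** * Solving for u by successive approximation *)

Section FourierSolution.
Variables (k : closedFieldType) (hk : [pchar k] =i pred0).
Variables (r s : nat) (r_gt0 : (0 < r)%N) (F : laurent k) (hF : lorder F (- s%:Z)).
Implicit Types u : laurent k.
Let N := (r + s)%N.

Let N0 : N%:R != 0 :> k.
Proof. by move/pcharf0P: hk => ->; rewrite addn_eq0 negb_and -lt0n r_gt0. Qed.

Definition sol_defect u : laurent k := lcomp F u + u ^+ r * lmono 1 (- N%:Z).

Lemma sol_defect_lbound u : lorder u 1 -> lbound (sol_defect u) (- s%:Z).
Proof.
move=> hu; apply: lboundD; first exact: (lcomp_lbound hu hF.2).
have := lboundM (lboundX1 hu r%:Z) (lbound_mono 1 (- N%:Z)).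
by rewrite (_ : r%:Z - N%:Z = - s%:Z) // /N; lia.
Qed.

(** For a solution this forces u_1^N = - F_(-s), the only equation for [u] that is not linear in the
    new coefficient. *)
Lemma sol_defect_lead u : lorder u 1 ->
  sol_defect u (- s%:Z) = (F (- s%:Z) + u 1 ^+ N) * u 1 ^ (- s%:Z).
Proof.
move=> hu; rewrite lcoefD (lcomp_lead hu hF.2).
have := lcoefM_lead (lboundX1 hu r%:Z) (lbound_mono 1 (- N%:Z)).
rewrite (_ : r%:Z - N%:Z = - s%:Z); last by rewrite /N; lia.
rewrite [u ^+ r]exprnP => ->; rewrite lcoefXz_lead // /= eqxx mulr1 mulrDl; congr (_ + _).
rewrite exprnP -expfzDr; last by case: hu.
by congr (_ ^ _); rewrite /N; lia.
Qed.

(** The linearized equation. The two terms contribute - s F_(-s) u_1^(-s-1) and r u_1^(r-1), and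
    u_1^N = - F_(-s) merges them into N u_1^(r-1), which is nonzero in characteristic zero. *)
Lemma sol_defect_diff u u' (i : int) : lorder u 1 -> lorder u' 1 -> u' 1 = u 1 ->
    u 1 ^+ N = - F (- s%:Z) -> lbound (u' - u) (i + 1) ->
  (sol_defect u' - sol_defect u) (i - s%:Z) =
    N%:R * u 1 ^ (r%:Z - 1) * (u' - u) (i + 1).
Proof.
move=> hu hu' uu'1 uN uu'.
have a0 : u 1 != 0 by case: hu.
have [_ cF] := lcomp_diff hu hu' uu'1 uu' hF.2.
have [br cr] := exprz_diff hu hu' uu'1 uu' r%:Z.
have ct := lcoefM_lead br (lbound_mono 1 (- N%:Z)).
have -> : sol_defect u' - sol_defect u = (lcomp F u' - lcomp F u) +
    (u' ^ r%:Z - u ^ r%:Z) * lmono 1 (- N%:Z).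
  by rewrite /sol_defect mulrBl opprD addrACA.
rewrite lcoefD [i - _]addrC cF.
have -> : - s%:Z + i = r%:Z + i - N%:Z by rewrite /N; lia.
rewrite ct cr /= eqxx mulr1.
have uNz : u 1 ^ (- s%:Z - 1) * u 1 ^+ N = u 1 ^ (r%:Z - 1).
  by rewrite exprnP -expfzDr //; congr (_ ^ _); rewrite /N; lia.
rewrite -[F _]opprK -uN -uNz /N natrD -pmulrn rmorphN /= -pmulrn; ring.
Qed.

Lemma sol_unique u u' : lorder u 1 -> lorder u' 1 -> u' 1 = u 1 ->
  sol_defect u = 0 -> sol_defect u' = 0 -> u' = u.
Proof.
move=> hu hu' uu'1 du du'.
have a0 : u 1 != 0 by case: hu.
have uN : u 1 ^+ N = - F (- s%:Z).
  have /esym/eqP := sol_defect_lead hu; rewrite du lcoef0 mulf_eq0.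
  by rewrite (negPf (expfz_neq0 _ a0)) orbF addrC addr_eq0 => /eqP.
apply/eqP; rewrite -subr_eq0; apply/eqP; apply: (@lbound_inf _ _ 1) => i.
elim: i => [|i IH]; first exact: lboundB hu'.2 hu.2.
rewrite -addn1 PoszD addrA; apply: (lboundS IH).
rewrite [1 + _]addrC in IH *; have := sol_defect_diff hu hu' uu'1 uN IH.
rewrite du du' subrr lcoef0 => /esym/eqP; rewrite !mulf_eq0.
by rewrite (negPf N0) (negPf (expfz_neq0 _ a0)) => /eqP.
Qed.

Lemma sol_exists : exists u, lorder u 1 /\ sol_defect u = 0.
Proof.
have N_gt0 : (0 < N)%N by rewrite addn_gt0 r_gt0.
have [al alN] : exists al : k, al ^+ N = - F (- s%:Z).
  have /closed_rootP[x] : size ('X^N + (F (- s%:Z))%:P : {poly k}) != 1%N.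
    by rewrite size_XnaddC // eqSS -lt0n.
  by rewrite rootE !hornerE addr_eq0 => /eqP xN; exists x.
have al0 : al != 0.
  apply: contra_eq_neq alN => ->.
  by rewrite expr0n gtn_eqF // eq_sym oppr_eq0; case: hF.
have ser_sub (y : nat -> k) :
    exists M, lbound (fun m : int => if m < 1 then 0 else y (absz (m - 1)%R)) M.
  by exists 1 => m m1; rewrite m1.
pose ser y : laurent k := Laurent (ser_sub y).
have serE y (i : nat) : ser y (i%:Z + 1) = y i.
  by rewrite /= ifF ?addrK //; lia.
have ser_order y : y 0%N = al -> lorder (ser y) 1.
  by move=> y0; split=> [|m m1]; [rewrite /= y0|rewrite /= m1].
(* Coefficient [i] sits in degree [i + 1], and by the linearized equation it governs the defect in
   degree [i - s]. *)
pose step i (y : nat -> k) := if i is 0 then al else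
  - sol_defect (ser y) (i%:Z - s%:Z) / (N%:R * al ^ (r%:Z - 1)).
have [x xE] := causal_rec 0 step.
have x0 : x 0%N = al by rewrite xE.
have hx := ser_order _ x0.
exists (ser x); split=> //; apply: (@lbound_inf _ _ (- s%:Z)) => i.
elim: i => [|i IH]; first by rewrite addr0; exact: sol_defect_lbound.
rewrite -addn1 PoszD addrA; apply: (lboundS IH); rewrite addrC.
case: i => [|i] in IH *.
  by rewrite sub0r sol_defect_lead // -[1]/(0%:Z + 1) serE x0 alN addrN mul0r.
pose y l := if (l < i.+1)%N then x l else 0.
have hy : lorder (ser y) 1 by apply: ser_order; rewrite /y /= x0.
have y1 : ser y 1 = al by rewrite -[1]/(0%:Z + 1) serE /y /= x0.
have xy1 : ser x 1 = ser y 1 by rewrite y1 -[1]/(0%:Z + 1) serE x0.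
have yN : ser y 1 ^+ N = - F (- s%:Z) by rewrite y1.
have xy : lbound (ser x - ser y) (i.+1%:Z + 1).
  move=> m mi; rewrite lcoefB /= /y; case: ltP => m1; rewrite ?subr0 //.
  by rewrite ifT ?subrr //; lia.
have yi : y i.+1 = 0 by rewrite /y ltnn.
have := sol_defect_diff hy hx xy1 yN xy.
rewrite !lcoefB !serE yi subr0 xE /step -/y y1 => /eqP.
rewrite mulrC divfK ?mulf_neq0 ?expfz_neq0 //.
by rewrite subr_eq addNr => /eqP.
Qed.

(** An N-th root of unity fixes zeta = tau^N, so it maps solutions to solutions; taking eta as the
    quotient of the leading coefficients reduces the claim to [sol_unique]. *)
Lemma sol_conj u u' : lorder u 1 -> lorder u' 1 ->
    sol_defect u = 0 -> sol_defect u' = 0 ->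
  exists2 eta : k, eta ^+ N = 1 & u' = twist eta u.
Proof.
move=> hu hu' du du'.
have a0 : u 1 != 0 by case: hu.
have leadN v : lorder v 1 -> sol_defect v = 0 -> v 1 ^+ N = - F (- s%:Z).
  move=> hv dv; have /esym/eqP := sol_defect_lead hv; rewrite dv lcoef0 mulf_eq0.
  by rewrite expfz_eq0 (negPf hv.1) andbF orbF addrC addr_eq0 => /eqP.
pose eta := u' 1 / u 1.
have eta0 : eta != 0 by rewrite mulf_neq0 ?invr_eq0 //; case: hu'.
have etaN : eta ^+ N = 1.
  by rewrite expr_div_n !leadN // divff // oppr_eq0; case: hF.
exists eta => //; apply: sol_unique => //.
- exact: lorder_twist.
- by rewrite twistE expr1z divfK.
have -> : sol_defect (twist eta u) = twist eta (sol_defect u).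
  rewrite /sol_defect twistD twistM // twist_mono twist_lcomp // twistX //.
  by rewrite -exprnN etaN invr1 mul1r.
by rewrite du; apply: laurentP => n; rewrite twistE !lcoef0 mulr0.
Qed.

End FourierSolution.

(** * Gauge transformations and uniqueness of the Fourier transform *)

Section FilteredBijection.
Variables (k : fieldType) (m : int) (T : laurent k -> laurent k).
Hypotheses (fT : filt m T) (T_lead : forall n, T (lmono 1 n) (n + m) != 0).

Lemma filt_lead_inj : injective T.
Proof.
move=> v w Tvw; apply/eqP; rewrite -subr_eq0; apply: contraT.
move=> /lorder_exists[n [vn vwn]].
have := filt_lead fT vwn; rewrite (filt_sub _ _ fT) Tvw subrr lcoef0 => /esym/eqP.
by rewrite mulf_eq0 (negPf (T_lead n)) orbF (negPf vn).
Qed.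

(** [T] is triangular on monomials with nonzero diagonal, so the coefficients of the preimage are
    found one after another. *)
Lemma filt_lead_surj (w : laurent k) (M : int) : lbound w (M + m) ->
  exists2 v : laurent k, lbound v M & T v = w.
Proof.
move=> wM.
have ser_sub (y : nat -> k) :
    exists N, lbound (fun n : int => if n < M then 0 else y (absz (n - M)%R)) N.
  by exists M => n nM; rewrite nM.
pose ser y : laurent k := Laurent (ser_sub y).
have serE y (i : nat) : ser y (M + i%:Z) = y i.
  by rewrite /= ifF ?[M + _]addrC ?addrK //; lia.
have serM y : lbound (ser y) M by move=> n nM; rewrite /= nM.
pose step i (y : nat -> k) := (w - T (ser y)) (M + i%:Z + m) /
  T (lmono 1 (M + i%:Z)) (M + i%:Z + m).
have [x xE] := causal_rec 0 step.
exists (ser x) => //; apply/esym/eqP; rewrite -subr_eq0; apply/eqP.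
apply: (@lbound_inf _ _ (M + m)) => i; elim: i => [|i IH].
  by rewrite addr0; apply: lboundB wM (fT.2 _ _ (serM _)).
rewrite -addn1 PoszD addrA; apply: (lboundS IH); rewrite addrAC.
pose y l := if (l < i)%N then x l else 0.
have xy : lbound (ser x - ser y) (M + i%:Z).
  move=> n ni; rewrite lcoefB /= /y; case: ltP => nM; rewrite ?subr0 //.
  by rewrite ifT ?subrr //; lia.
have -> : w - T (ser x) = w - T (ser y) - T (ser x - ser y).
  by rewrite (filt_sub _ _ fT); ring.
have xyi : (ser x - ser y) (M + i%:Z) = x i.
  by rewrite lcoefB !serE /y ltnn subr0.
by rewrite [LHS]lcoefB (filt_lead fT xy) xyi xE /step -/y divfK ?subrr.
Qed.

Lemma filt_lead_bij : exists psi : laurent k -> laurent k,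
  [/\ cancel T psi, cancel psi T &
      forall (w : laurent k) M, lbound w (M + m) -> lbound (psi w) M].
Proof.
have /choice[psi psiK] : forall w, exists v, T v = w.
  move=> w; have [N wN] := lcoefP w.
  have wN' : lbound w (N - m + m) by rewrite subrK.
  by have [v _ <-] := filt_lead_surj wN'; exists v.
exists psi; split=> // [v|w M wM]; first exact: filt_lead_inj.
have [v vM <-] := filt_lead_surj wM.
by rewrite (_ : psi (T v) = v) //; apply: filt_lead_inj.
Qed.

End FilteredBijection.

(** C is the exponential of a primitive of D dtau / tau; its coefficients solve n C_n = (D C)_n,
    where only earlier C_j occur on the right because D has positive order. *)
Lemma log_derivative_exists (k : fieldType) (D : laurent k) :
    [pchar k] =i pred0 -> lbound D 1 ->
  exists2 C : laurent k, lorder C 0 & theta C = D * C.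
Proof.
move=> /pcharf0P hk D1.
have ser_sub (y : nat -> k) :
    exists N, lbound (fun n : int => if n < 0 then 0 else y (absz n)) N.
  by exists 0 => n n0; rewrite n0.
pose ser y : laurent k := Laurent (ser_sub y).
have ser0 y : lbound (ser y) 0 by move=> n n0; rewrite /= n0.
pose step i (y : nat -> k) := if i is 0%N then 1 else (D * ser y) i%:Z / i%:R.
have [x xE] := causal_rec 0 step.
exists (ser x); first by split; rewrite /= ?xE ?oner_neq0 //; exact: ser0.
apply: laurentP => n; case: (ltP n 0) => n0.
  by rewrite (lbound_theta (ser0 x) n0) (lboundM D1 (ser0 x)) //; lia.
rewrite -(gez0_abs n0); case: (absz n) => [|i].
  by rewrite (lboundM D1 (ser0 x)) //= mul0r.
pose y l := if (l < i.+1)%N then x l else 0.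
have xy : lbound (ser x - ser y) i.+1%:Z.
  move=> j ji; rewrite lcoefB /= /y; case: ltP => j0; rewrite ?subr0 //.
  by rewrite ifT ?subrr //; lia.
have -> : D * ser x = D * ser y + D * (ser x - ser y) by ring.
rewrite lcoefD (lboundM D1 xy) ?addr0; last by lia.
rewrite -[LHS]/(i.+1%:R * x i.+1) xE /step -/y mulrC divfK //.
by rewrite hk.
Qed.

(** Replacing T by c T subtracts theta(c) / (N c) from G. This must equal G - g, whose constant term
    [r / N] makes [c] equal to tau^r times a series with nonzero constant term. *)
Lemma transform_spec_gauge (k : fieldType) (hk : [pchar k] =i pred0) (r s : nat)
    (F G g : laurent k) (T : laurent k -> laurent k) : (0 < r)%N ->
    transform_spec r s F G 0 T ->
    lbound (G - g - lconst (r%:R / (r + s)%:R)) 1 ->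
  exists T', transform_spec r s F g r%:Z T'.
Proof.
set N := (r + s)%N => r_gt0 [fT T_lead TN Tz] Gg.
have N0 : N%:R != 0 :> k.
  by move/pcharf0P: (hk) => ->; rewrite addn_eq0 negb_and -lt0n r_gt0.
have D1 := lboundM (lbound_const N%:R) Gg.
have [C C0 CD] := log_derivative_exists hk D1.
pose c := lmono 1 r%:Z * C.
have hc : lbound c (r%:Z + 0) := lboundM (lbound_mono 1 r%:Z) C0.2.
have NN : lconst N%:R^-1 * lconst N%:R = 1 :> laurent k by rewrite -lconstM mulVf.
have NrN : lconst N%:R * lconst (r%:R / N%:R) = lconst r%:R :> laurent k.
  by rewrite -lconstM mulrC divfK.
have cD : theta c = lconst N%:R * (G - g) * c.
  rewrite /c thetaM theta_mono CD -[r%:Z%:~R]/(r%:R : k).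
  transitivity (lconst N%:R * (G - g) * (lmono 1 r%:Z * C) + (lconst r%:R -
     lconst N%:R * lconst (r%:R / N%:R)) * (lmono 1 r%:Z * C)); first by ring.
  by rewrite NrN subrr mul0r addr0.
exists (fun v => c * T v); split=> [|n|v|v].
- by have := filtM hc fT; rewrite !addr0.
- have Tn : lbound (T (lmono 1 n)) (n + 0) := fT.2 _ _ (lbound_mono 1 n).
  rewrite (_ : n + r%:Z = r%:Z + 0 + (n + 0)); last by ring.
  rewrite (lcoefM_lead hc Tn) mulf_neq0 //.
  by rewrite (lcoefM_lead (lbound_mono 1 r%:Z) C0.2) /= eqxx mul1r; case: C0.
- by rewrite TN; ring.
rewrite Tz thetaM cD; transitivity (- lmono 1 N%:Z * (lconst N%:R^-1 * (c * theta (T v))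
   + (lconst N%:R^-1 * lconst N%:R) * (G - g) * c * T v + g * (c * T v))); last by ring.
by rewrite NN; ring.
Qed.

(** * Uniqueness of the local Fourier transform *)

Section FourierUnique.
Variables (k : fieldType) (E : connection k) (nhE : no_horizontal E).

Section Action.
Variables (W : connection k) (phi : E -> W) (psi : W -> E).
Hypothesis H : fourier_0oo_via phi psi.
Definition zeta_act (h : laurent k) (v : E) : E := psi (h *: phi v).

Let phiK := fourier_phiK H.
Let psiK := fourier_psiK H.

Lemma fourier_phiD u v : phi (u + v) = phi u + phi v.
Proof. by have := fourier_linear H 1 u v; rewrite lconst1 !scale1r. Qed.

Lemma fourier_phi0 : phi 0 = 0.
Proof. by apply: (addIr (phi 0)); rewrite -fourier_phiD !add0r. Qed.

Lemma zeta_actM g h v : zeta_act (g * h) v = zeta_act g (zeta_act h v).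
Proof. by rewrite /zeta_act psiK scalerA. Qed.

Lemma zeta_act1 v : zeta_act 1 v = v.
Proof. by rewrite /zeta_act scale1r phiK. Qed.

Lemma zeta_actD g h v : zeta_act (g + h) v = zeta_act g v + zeta_act h v.
Proof.
by apply: (can_inj phiK); rewrite fourier_phiD /zeta_act !psiK scalerDl.
Qed.

Lemma zeta_act_const c v : zeta_act (lconst c) v = lconst c *: v.
Proof.
apply: (can_inj phiK); rewrite psiK.
by have := fourier_linear H c v 0; rewrite !addr0 fourier_phi0 addr0.
Qed.

End Action.

Section Comparison.
Variables (W W' : connection k) (phi : E -> W) (psi : W -> E).
Variables (phi' : E -> W') (psi' : W' -> E).
Hypotheses (H : fourier_0oo_via phi psi) (H' : fourier_0oo_via phi' psi').

Let act := zeta_act phi psi.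
Let act' := zeta_act phi' psi'.
(** These [h] form a subfield containing the constants. It contains zeta because both actions send
    [v] to a solution w of nabla w = - v, and nabla is injective. So it contains all Laurent
    polynomials. *)
Let same h := forall v, act h v = act' h v.

Let sameM g h : same g -> same h -> same (g * h).
Proof.
by move=> sg sh v; rewrite /act /act' (zeta_actM H) (zeta_actM H') -/act -/act' sh sg.
Qed.

Let sameD g h : same g -> same h -> same (g + h).
Proof.
by move=> sg sh v; rewrite /act /act' (zeta_actD H) (zeta_actD H') -/act -/act' sh sg.
Qed.

Let same_const c : same (lconst c).
Proof. by move=> v; rewrite /act /act' (zeta_act_const H) (zeta_act_const H'). Qed.

Let same_X : same lX.
Proof.
move=> v; apply/eqP; rewrite -subr_eq0; apply/eqP; apply: nhE.
have := nabla_linear (-1) (act' lX v) (act lX v).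
rewrite lconstN lconst1 !scaleN1r addrC => ->.
by rewrite (fourier_nabla_zeta H) (fourier_nabla_zeta H') addrC subrr.
Qed.

Let same_V h : h != 0 -> same h -> same h^-1.
Proof.
move=> h0 sh v.
have hV : act h (act' h^-1 v) = v.
  by rewrite sh /act' -(zeta_actM H') mulfV // (zeta_act1 H').
by rewrite -{1}hV /act -(zeta_actM H) mulVf // (zeta_act1 H).
Qed.

Let same_mono x n : same (lmono x n).
Proof.
rewrite lmono_split; apply: sameM => //.
have lX0 : lX != 0 :> laurent k := lmono_neq0 k 1.
elim/int_ind: n => [|n IH|n IH]; first exact: same_const.
- rewrite (_ : lmono 1 n.+1%:Z = lX * lmono 1 n%:Z); first exact: sameM.
  by rewrite lmonoM mulr1; congr lmono; lia.
- rewrite (_ : lmono 1 (- n.+1%:Z) = lX^-1 * lmono 1 (- n%:Z)).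
    by apply: sameM IH; apply: same_V.
  by rewrite lmonoV lmonoM mulr1; congr lmono; lia.
Qed.

(** Laurent polynomials approximate [h], and both actions are continuous when tested by linear
    forms; the coordinate forms of a basis separate vectors. *)
Lemma zeta_act_unique h v : act h v = act' h v.
Proof.
have lin0 (l : {linear E -> (laurent k)^o}) : l (act h v) - l (act' h v) = 0.
  have [n hn] := lcoefP h.
  apply: (@lbound_inf _ _ 0) => i.
  have [M1 H1] := fourier_continuous H v l (0 + i%:Z).
  have [M2 H2] := fourier_continuous H' v l (0 + i%:Z).
  pose M := Order.max M1 M2.
  have [p [sp hp]] : exists p : laurent k, same p /\ lbound (h - p) M.
    suff [p [sp hp]] : exists p : laurent k, same p /\ lbound (h - p) (n + (absz (M - n)%R)%:Z).
      by exists p; split=> //; apply: lbound_le hp; lia.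
    elim: (absz _) => [|j [p [sp hp]]].
      exists 0; split; first by rewrite -(lconst0 k); exact: same_const.
      by rewrite subr0 addr0.
    exists (p + lmono ((h - p) (n + j%:Z)) (n + j%:Z)); split.
      exact: sameD sp (same_mono _ _).
    rewrite opprD addrA -addn1 PoszD addrA; apply: lboundS.
      exact: lboundB hp (lbound_mono _ _).
    by rewrite lcoefB /= eqxx subrr.
  have -> : l (act h v) - l (act' h v) = l (act (h - p) v) - l (act' (h - p) v).
    have E1 : act h v = act (h - p) v + act p v.
      by rewrite /act -(zeta_actD H) subrK.
    have E2 : act' h v = act' (h - p) v + act p v.
      by rewrite sp /act' -(zeta_actD H') subrK.
    by rewrite E1 E2 !(linearD l) opprD addrACA subrr addr0.
  apply: lboundB.
    by apply: (H1 (h - p)); apply: lbound_le hp; rewrite le_max lexx.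
  by apply: (H2 (h - p)); apply: lbound_le hp; rewrite le_max lexx orbT.
rewrite (coord_vbasis (memvf (act h v))) (coord_vbasis (memvf (act' h v))).
apply: eq_bigr => j _; congr (_ *: _); apply/eqP; rewrite -subr_eq0; apply/eqP.
exact: (lin0 (coord (vbasis fullv) j : {linear E -> (laurent k)^o})).
Qed.

(** The identity of [E], read as a map from [W'] to [W], is linear because the two actions agree,
    and it is horizontal because both connections are prescribed by the same formula on [E]. *)
Lemma fourier_unique : conn_isom W' W.
Proof.
pose f w := phi (psi' w).
have f_lin : linear f.
  move=> h w1 w2; rewrite /f -{1}[w1](fourier_psiK H') -{1}[w2](fourier_psiK H').
  have -> : psi' (h *: phi' (psi' w1) + phi' (psi' w2)) =
      act' h (psi' w1) + psi' w2.
    apply: (can_inj (fourier_phiK H')).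
    by rewrite (fourier_phiD H') /act' /zeta_act !(fourier_psiK H').
  by rewrite (fourier_phiD H) -zeta_act_unique /act /zeta_act (fourier_psiK H).
pose m := GRing.isLinear.Build _ _ _ _ f f_lin.
exists (HB.pack f m : {linear W' -> W}); split.
  exists (fun w => phi' (psi w)) => w.
    by rewrite /= /f (fourier_phiK H) (fourier_psiK H').
  by rewrite /= /f (fourier_phiK H') (fourier_psiK H).
move=> w; rewrite /= /f -{1}[w](fourier_psiK H') (fourier_connection H').
apply: (can_inj (fourier_psiK H)); rewrite (fourier_phiK H) (fourier_connection H).
by rewrite -/(zeta_act _ _ _ _) -/(zeta_act phi psi _ _) -/act -/act' zeta_act_unique.
Qed.

End Comparison.
End FourierUnique.

(** * Ramification *)

Lemma RclassP (k : fieldType) q (f g : puiseux k q) :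
  Rclass f = Rclass g <-> exists eta : k, exists m : int, eta ^+ ramdeg q = 1 /\
    lbound (g - twist eta f - lconst (m%:~R / (ramdeg q)%:R) : laurent k) 1.
Proof.
rewrite /Rclass; split=> [/eqP|H]; last apply/eqP; rewrite eqmodE /= /Rrel.
  case/asboolP => eta [m [eta1 fg]]; by exists eta, m.
case: H => eta [m [eta1 fg]]; by apply/asboolP; exists eta, m.
Qed.

Lemma ramdegE q : (0 < q)%N -> ramdeg q = q.
Proof. by case: q. Qed.

Section NegativeSupport.
Variables (k : closedFieldType) (hk : [pchar k] =i pred0).

(** A root of 1 + X + ... + X^(p-1) is not 1 in characteristic zero; by Bezout its order is exactly
    [p]. *)
Lemma prime_root_of_unity (p : nat) : prime p ->
  exists2 xi : k, xi ^+ p = 1 & forall n : int, xi ^ n = 1 -> (p %| n)%Z.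
Proof.
move=> p_pr; have p1 := prime_gt1 p_pr; have p0 := prime_gt0 p_pr.
pose P : {poly k} := \poly_(i < p) 1.
have sP : size P = p.
  by apply: size_poly_eq; rewrite oner_neq0.
have /closed_rootP[xi] : size P != 1%N by rewrite sP gtn_eqF.
rewrite rootE horner_poly => /eqP xiP.
have xi_p : xi ^+ p = 1.
  have := subrX1 xi p; rewrite (eq_bigr (fun i : 'I_p => 1 * xi ^+ i)); last first.
    by move=> i _; rewrite mul1r.
  by rewrite xiP mulr0 => /eqP; rewrite subr_eq0 => /eqP.
have xi1 : xi != 1.
  apply/eqP => xi1; move: xiP; rewrite xi1.
  under eq_bigr do rewrite expr1n mulr1.
  rewrite sumr_const card_ord => /eqP; rewrite (pcharf0P k).1 //.
  by rewrite gtn_eqF.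
exists xi => // n xin; apply: contraT => pn.
have cop : coprimez p n.
  by rewrite coprimezE prime_coprime // -[X in (X %| _)%N]/(absz p%:Z) -dvdzE.
have [a [b ab]] := Bezoutz p n.
have xi0 : xi != 0.
  by apply: contra_eq_neq xi_p => ->; rewrite expr0n gtn_eqF // eq_sym oner_neq0.
case/negP: xi1; apply/eqP.
rewrite -[xi]expr1z -(eqP cop) -ab expfzDr // [a * _]mulrC [b * _]mulrC.
by rewrite -!exprz_exp xin -exprnP xi_p !exp1rz mulr1.
Qed.

Lemma lcomp_lboundV (G u : laurent k) M : lorder u 1 ->
  lbound (lcomp G u) M -> lbound G M.
Proof.
move=> hu GM; have [->|/lorder_exists[n [Gn Gb]]] := eqVneq G 0; first exact: lbound0.
have := lcomp_lead hu Gb; have [nM|Mn] := ltP n M; last by move=> _; exact: lbound_le Gb.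
rewrite GM // => /esym/eqP; rewrite mulf_eq0 (negPf Gn) /=.
by rewrite (negPf (expfz_neq0 _ _)) //; case: hu.
Qed.

Lemma lcomp_scale (xi : k) (F u : laurent k) : xi != 0 -> lorder u 1 ->
  lcomp F (lconst xi * u) = lcomp (twist xi F) u.
Proof.
move=> xi0 hu; have w := lcompX_weight_bound hu.
have hxu : lorder (lconst xi * u) 1.
  split; first by rewrite lcoefZ mulf_neq0 //; case: hu.
  by have := lboundM (lbound_const xi) hu.2.
have w' := lcompX_weight_bound hxu.
have ft : filt 0 (twist xi).
  split=> [x a b|a M aM]; last by rewrite addr0; exact: lbound_twist.
  by rewrite twistD twistM // twist_mono expr0z mul1r.
apply: (filt_ext (lser_filt w') (filt_comp (lser_filt w) ft)) => n.
rewrite (lser_mono w') twist_mono mulr1 (filt_mono _ _ (lser_filt w)) (lser_mono w).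
rewrite expfzMl; congr (_ * _).
case: n => m; first exact: lconstX.
rewrite NegzE -!exprnN lconstX.
have xm0 : xi ^+ m.+1 != 0 by rewrite expf_neq0.
have cm0 : lconst (xi ^+ m.+1) != 0.
  apply/eqP => /(congr1 (fun a : laurent k => a 0)); rewrite lcoef0 /= => /eqP.
  by rewrite (negPf xm0).
by apply: (mulfI cm0); rewrite mulfV // -lconstM mulfV.
Qed.

Variables (r s : nat) (r_gt0 : (0 < r)%N) (s_gt0 : (0 < s)%N).
Variables (F u : laurent k) (p : nat).
Hypotheses (hF : lorder F (- s%:Z)) (hu : lorder u 1) (du : sol_defect r s F u = 0).
Hypotheses (p_pr : prime p) (pN : (p %| r + s)%N).
Hypothesis Y_supp : forall n : int, n < 0 -> ~~ (p %| n)%Z -> lcomp F u n = 0.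

(** F(u) has order exactly [-s], so the support condition gives that [p] divides [s], hence also
    [r]. *)
Lemma sol_support_dvd : (p %| r)%N.
Proof.
have ps : (p %| s)%N.
  apply: contraT => ps; have /esym/eqP := lcomp_lead hu hF.2.
  rewrite Y_supp ?oppr_lt0 // ?dvdzE ?abszN //.
  by rewrite mulf_eq0 (negPf hF.1) (negPf (expfz_neq0 _ hu.1)).
by rewrite -(dvdn_addl _ ps).
Qed.

Lemma sol_support n : n < 0 -> ~~ (p %| n)%Z -> F n = 0.
Proof.
move=> n0 pn; have pr := sol_support_dvd.
have [xi xi_p xi_dvd] := prime_root_of_unity p_pr.
have xi0 : xi != 0.
  apply: contra_eq_neq xi_p => ->.
  by rewrite expr0n gtn_eqF ?prime_gt0 // eq_sym oner_neq0.
have xiM (m : int) : (p %| m)%Z -> xi ^ m = 1.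
  by case/dvdzP => q ->; rewrite mulrC -exprz_exp -exprnP xi_p exp1rz.
pose Y := lcomp F u; pose N := (r + s)%N.
have tY0 : lbound (twist xi Y - Y) 0.
  move=> m m0; rewrite lcoefB twistE.
  have [/xiM->|pm] := boolP (p %| m)%Z; first by rewrite mul1r subrr.
  by rewrite Y_supp // mulr0 subrr.
have YE : Y = - u ^+ r * lmono 1 (- N%:Z).
  by rewrite /Y; move/eqP: du; rewrite /sol_defect addr_eq0 => /eqP->; rewrite mulNr.
(* Dividing by xi restores the leading coefficient of [u], and the r-th power is unaffected since
   [p] divides [r]. *)
pose u' := lconst xi^-1 * twist xi u.
have hu' : lorder u' 1.
  have [tu tub] := lorder_twist xi0 hu.
  by split; [rewrite lcoefZ mulf_neq0 ?invr_eq0|have := lboundM (lbound_const xi^-1) tub].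
have u'1 : u' 1 = u 1 by rewrite lcoefZ twistE expr1z mulKf.
have u'r : u' ^+ r = twist xi (u ^+ r).
  rewrite exprMn twistX //; suff -> : lconst xi^-1 ^+ r = 1 by rewrite mul1r.
  by rewrite lconstX exprVn exprnP xiM ?invr1 // dvdzE.
have u'uN : lbound (u' ^+ r - u ^+ r) N%:Z.
  have -> : u' ^+ r - u ^+ r = (twist xi Y - Y) * (- lmono 1 N%:Z).
    rewrite YE twistM // twistN twist_mono mulr1 xiM; last first.
      by rewrite dvdzE abszN.
    have zN : lmono 1 (- N%:Z) * lmono 1 N%:Z = 1 :> laurent k.
      by rewrite lmonoM mulr1 addNr.
    rewrite u'r; transitivity ((twist xi (u ^+ r) - u ^+ r) *
      (lmono 1 (- N%:Z) * lmono 1 N%:Z)); [by rewrite zN mulr1|by ring].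
  by have := lboundM tY0 (lboundN (lbound_mono 1 N%:Z)); rewrite add0r.
have r0 : r%:R != 0 :> k by rewrite (pcharf0P k).1 // -lt0n.
(* As long as the difference starts in degree [i + 1] with [i < s], the difference of the r-th
   powers starts in degree [r + i < N] with a nonzero multiple of the same coefficient, which must
   vanish. *)
have u'u : lbound (u' - u) (s%:Z + 1).
  suff H i : (i <= s)%N -> lbound (u' - u) (i%:Z + 1) by exact: H.
  elim: i => [_|i IH lis]; first by rewrite add0r; exact: lboundB hu'.2 hu.2.
  have {}IH := IH (ltnW lis).
  rewrite -addn1 PoszD; apply: (lboundS IH).
  have [_] := exprz_diff hu hu' u'1 IH r%:Z.
  rewrite -!exprnP u'uN; last by rewrite /N; lia.
  move=> /esym/eqP; rewrite !mulf_eq0 (negPf (expfz_neq0 _ hu.1)) -pmulrn (negPf r0).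
  by move/eqP.
have tF : lbound (twist xi F) (- s%:Z) := lbound_twist xi hF.2.
have [diff _] := lcomp_diff hu hu' u'1 u'u tF.
rewrite addNr in diff.
have tY : twist xi Y = lcomp (twist xi F) u'.
  rewrite -lcomp_scale // /u' mulrA -lconstM mulfV // lconst1 mul1r.
  by rewrite twist_lcomp.
have fc := lser_filt (lcompX_weight_bound hu).
(* Since F(xi t) has order at least [-s], replacing [u'] by [u] in it changes no polar term. *)
have : lbound (lcomp (twist xi F - F) u) 0.
  rewrite lcomp_lser (filt_sub _ _ fc) -!lcomp_lser -/Y.
  rewrite (_ : _ - Y = (twist xi Y - Y) - (lcomp (twist xi F) u' - lcomp (twist xi F) u)).
    exact: lboundB.
  by rewrite tY opprB [RHS]addrC addrA subrK.
move/(lcomp_lboundV hu) => /(_ n n0); rewrite lcoefB twistE => /eqP.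
rewrite -{2}[F n]mul1r -mulrBl mulf_eq0 subr_eq0 => /orP[/eqP/xi_dvd|/eqP//].
by move=> pn'; rewrite pn' in pn.
Qed.

End NegativeSupport.

Section Rcirc.
Variables (k : closedFieldType) (hk : [pchar k] =i pred0).

(** If the polar exponents were all multiples of [p], the part of [f] in degrees at most 0 would be
    a representative lying in K_(q/p). *)
Lemma Rcirc_support q (f : puiseux k q) (p : nat) : (0 < q)%N -> prime p -> (p %| q)%N ->
  Rcirc (Rclass f) -> ~ (forall n : int, n < 0 -> ~~ (p %| n)%Z -> f n = 0).
Proof.
move=> q0 p_pr /dvdnP[q' qE] circ supp.
have p0 := prime_gt0 p_pr; have p1 := prime_gt1 p_pr.
have q'0 : (0 < q')%N by case: q' qE q0 => // ->.
have [] := circ q'.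
  by rewrite q'0 qE -{1}[q']muln1 ltn_pmul2l.
have trP : exists N, lbound (fun n : int => if n <= 0 then f n else 0) N.
  by have [N fN] := lcoefP f; exists N => n nN; rewrite fN // if_same.
pose f' : puiseux k q := Laurent trP.
have hP : exists N, lbound (fun n : int => f' (n * p%:Z)) N.
  have [N fN] := lcoefP f'; exists (- (absz N)%:Z) => n nN; apply: fN.
  by have := p0; nia.
pose h : puiseux k q' := Laurent hP.
exists f', h; split.
  apply/RclassP; exists 1, 0; split; first by rewrite expr1n.
  move=> n n1; rewrite !lcoefB twistE exp1rz mul1r /= mul0r if_same subr0.
  by rewrite ifT ?subrr //; lia.
apply: laurentP => n /=; rewrite !ramdegE //.
have [/dvdzP[m nE]|q'n] := boolP (q' %| n)%Z; last first.
  rewrite ifF //; apply: contraNF q'n; rewrite qE PoszM.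
  by apply: dvdz_trans; rewrite dvdz_mulr.
rewrite nE mulzK; last by lia.
case: (boolP (q%:Z %| m * q'%:Z)%Z); rewrite {1}qE PoszM.
  case/dvdzP => j jE.
  have mE : m = j * p%:Z.
    by apply: (mulIf (_ : q'%:Z != 0)); [lia|rewrite jE mulrA mulrAC].
  have -> : (m * q'%:Z %/ q)%Z = j.
    by rewrite jE -PoszM -qE mulzK //; lia.
  by rewrite mE.
rewrite mulrC dvdz_mul2l; last by lia.
move=> pm; case: leP => // m0; have [m0'|m0'] := eqVneq m 0.
  by rewrite m0' dvdz0 in pm.
by apply: supp => //; rewrite lt_neqAle m0'.
Qed.

(** With no polar part, any prime divisor of [q] would allow a smaller ramification. *)
Lemma Rcirc_order0 q (f : puiseux k q) : (0 < q)%N -> lbound f 0 ->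
  Rcirc (Rclass f) -> q = 1%N.
Proof.
move=> q0 f0 circ; apply/eqP; apply: contraT => q1.
have q_gt1 : (1 < q)%N by rewrite ltn_neqAle eq_sym q1.
have [p p_pr pq] := pdivP q_gt1.
by case: (Rcirc_support q0 p_pr pq circ) => n n0 _; exact: f0.
Qed.

End Rcirc.

(** * The local Fourier transform of E_f *)

Section FourierTransform.
Variables (k : fieldType) (hk : [pchar k] =i pred0).

Lemma ramify_monoE q (x : k) n : (0 < q)%N -> ramify q (lmono x n) = lmono x (n * q%:Z).
Proof. by move=> q0; rewrite ramify_mono ramdegE. Qed.

Lemma elem_nablaE q (f v : puiseux k q) : (0 < q)%N ->
  elem_nabla f v = nabla_t q f v.
Proof.
move=> q0.
have E1 : pderiv v = lmono q%:R^-1 (- q%:Z) * theta v :> laurent k.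
  by rewrite pderivE ramdegE.
have E2 : lX^-1 *: (f * v) = lmono 1 (- q%:Z) * (f * v : laurent k) :> laurent k.
  by rewrite pscaleE lmonoV ramify_monoE // mulN1r.
have -> : nabla_t q f v =
    lmono q%:R^-1 (- q%:Z) * theta v + lmono 1 (- q%:Z) * (f * v : laurent k).
  by rewrite /nabla_t mulrDr mulrA lmonoM mul1r addr0.
by rewrite -E1 -E2.
Qed.

(** In the basis 1, t, ..., t^(q-1) a linear form is a finite sum of coordinates times fixed
    series. *)
Lemma linear_form_continuous q (l : {linear puiseux k q -> (laurent k)^o}) (N : int) :
  exists M : int, forall x : laurent k, lbound x M -> lbound (l x : laurent k) N.
Proof.
pose t (i : 'I_(ramdeg q)) : puiseux k q := lmono 1 i%:Z.
have /choice[Mf MfP] : forall i, exists M : int, forall x : laurent k,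
    lbound x M -> lbound (slice i x * (l (t i) : laurent k)) N.
  move=> i; have [b lb] := lcoefP (l (t i)).
  exists ((N - b) * (ramdeg q)%:Z) => x xM; rewrite -[N](subrK b).
  apply: lboundM lb => n nN; apply: xM => /=.
  by have := ltn_ord i; nia.
exists (\sum_i absz (Mf i))%:Z => x xM.
have -> : l x = \sum_i (slice i x *: l (t i)).
  rewrite -{1}[x](to_rowK (q := q)) /of_row linear_sum; apply: eq_bigr => i _.
  by rewrite -linearZ mxE.
have : forall i, lbound (slice i x *: l (t i) : laurent k) N.
  move=> i; apply: MfP; apply: lbound_le xM.
  by rewrite (bigD1 i) //=; lia.
move=> H n nN; rewrite (lcoef_sum (fun i => slice i x *: l (t i))) big1 // => i _.
exact: H.
Qed.

Variables (r s : nat) (r_gt0 : (0 < r)%N).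
Let N := (r + s)%N.
Let N_gt0 : (0 < N)%N. Proof. by rewrite addn_gt0 r_gt0. Qed.
Variables (F : puiseux k r) (g : puiseux k (r + s)) (m : int).
Variable T : laurent k -> laurent k.
Hypothesis T_spec : transform_spec r s F g m T.

Lemma transform_no_horizontal : no_horizontal (elem_conn hk F).
Proof.
case: T_spec => fT T_lead TN _ v /= v0.
rewrite elem_nablaE // in v0; have := TN v; rewrite v0 (filt0 fT) => /esym/eqP.
rewrite mulf_eq0 oppr_eq0 (negPf (lmono_neq0 _ _)) /= => /eqP Tv0.
by apply: (filt_lead_inj fT T_lead); rewrite (filt0 fT).
Qed.

Lemma transform_fourier : fourier_0oo (elem_conn hk F) (elem_conn hk g).
Proof.
split; first exact: transform_no_horizontal.
have [fT T_lead TN Tz] := T_spec.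
have [psi [TK psiK psi_bound]] := filt_lead_bij fT T_lead.
have scaleT (h : laurent k) (w : puiseux k N) : h *: w = ramify N h * w by [].
have scaleX (w : puiseux k N) : lX *: w = lmono 1 N%:Z * w.
  by rewrite scaleT ramify_monoE // mul1r.
have zN : lmono 1 (- N%:Z) * lmono 1 N%:Z = 1 :> laurent k.
  by rewrite lmonoM mulr1 addNr.
have nablaF (v : puiseux k r) : elem_nabla F v = nabla_t r F v by exact: elem_nablaE.
have nablag (w : puiseux k N) : elem_nabla g w = nabla_t N g w by exact: elem_nablaE.
have psiN w : psi (- w) = - psi w.
  by apply: (can_inj TK); rewrite psiK (filt_opp _ fT) psiK.
exists T, psi; split=> //.
- move=> c u v; rewrite -[LHS]/(T (ramify r (lconst c) * u + v)) ramify_const fT.1.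
  by rewrite -[RHS]/(ramify N (lconst c) * T u + T v) ramify_const.
- move=> v; rewrite -[LHS]/(psi (lX *: (T (elem_nabla F v) : puiseux k N))).
  rewrite scaleX nablaF TN mulrA mulrN [lmono 1 N%:Z * _]mulrC zN mulN1r psiN.
  by rewrite TK.
- move=> v; rewrite -[LHS]/(elem_nabla F (psi (lX *: (T v : puiseux k N)))).
  apply: (can_inj TK); rewrite nablaF TN psiK scaleX mulNr mulrA zN mul1r.
  by rewrite (filt_opp _ fT).
- move=> v l K.
  have [M lM] := linear_form_continuous l K.
  have [b Tb] := lcoefP (T v).
  (* The bound is taken nonnegative, so that substituting tau^N for zeta, which multiplies orders by
     N >= 1, preserves it. *)
  exists (absz (M - b + m)%R)%:Z => h hM; apply: lM.
  rewrite -[X in lbound X]/(lcoef (psi (ramify N h * T v))); apply: psi_bound.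
  apply: lbound_le (lboundM (_ : lbound (ramify N h) ((absz (M - b + m)%R)%:Z)) Tb).
    by lia.
  move=> n nM; rewrite /= ramdegE //; case: ifP => // /divzK nE; apply: hM.
  by have := N_gt0; nia.
- move=> v; rewrite -[LHS]/(psi (elem_nabla g (T v))).
  rewrite -[RHS]/(- psi (ramify N (lX ^- 2) * T (ramify r lX * v))).
  have -> : ramify N (lX ^- 2) = lmono 1 (- N%:Z) * lmono 1 (- N%:Z) :> laurent k.
    have -> : lX ^- 2 = lmono 1 (- 2) :> laurent k by rewrite expr2 lmonoM mulr1 lmonoV.
    by rewrite ramify_monoE // lmonoM mulr1; congr lmono; ring.
  rewrite ramify_monoE // mul1r Tz nablag -psiN; congr psi.
  rewrite /nabla_t -[(r + s)%N]/N mulNr mulrN opprK [RHS]mulrA.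
  by rewrite -[X in _ = X * _]mulrA zN mulr1.
Qed.

End FourierTransform.

(** * The class of g and the proof of the theorem *)

Section Main.
Variables (k : closedFieldType) (hk : [pchar k] =i pred0).
Variables (s r : nat) (r_gt0 : (0 < r)%N) (F : puiseux k r).
Hypotheses (F_circ : Rcirc (Rclass F)) (F_ord : lorder F (- s%:Z)).
Hypothesis F_neq0 : Rclass F <> Rclass 0.
Let N := (r + s)%N.
Let N_gt0 : (0 < N)%N. Proof. by rewrite addn_gt0 r_gt0. Qed.

Lemma fourier_solP (u : puiseux k (r + s)) :
  fourier_sol F u <-> lorder u 1 /\ sol_defect r s F u = 0.
Proof.
rewrite /fourier_sol ramify_monoE // mul1r lmonoV.
split=> -[hu uE]; split=> //; first by rewrite /sol_defect uE mulNr addNr.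
by apply/eqP; move/eqP: uE; rewrite /sol_defect addr_eq0 -mulNr.
Qed.

(** For [r = 1] the quotient is by series of positive order and integers, so a nonzero class of
    order 0 has a constant term that is not an integer. *)
Lemma fourier_regular : s = 0%N -> r = 1%N /\ forall n : int, F 0 + n%:~R != 0.
Proof.
move=> s0; have F0 : lbound F 0 by have := F_ord.2; rewrite s0.
have r1 := Rcirc_order0 r_gt0 F0 F_circ; split=> // n.
apply/negP => /eqP F0n; apply: F_neq0; apply/RclassP; exists 1, n.
split; first by rewrite expr1n.
rewrite ramdegE // r1 divr1 => j j1; rewrite !lcoefB twistE exp1rz mul1r lcoef0 sub0r /=.
have [->|j0] := eqVneq j 0; first by rewrite -opprD F0n oppr0.
by rewrite F0 ?subr0 ?oppr0 //; lia.
Qed.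

Lemma fourier_transform_spec (u : puiseux k (r + s)) : fourier_sol F u ->
  exists T, transform_spec r s F (fourier_g F u) r%:Z T.
Proof.
case/fourier_solP => hu du.
have hFu : lcomp F u = - u ^+ r * lmono 1 (- (r + s)%N%:Z).
  by apply/eqP; move/eqP: du; rewrite /sol_defect addr_eq0 -mulNr.
suff [G [T [TG Gg]]] : exists G T, transform_spec r s F G 0 T /\
    lbound (G - lcomp F u - lconst (s%:R / (2 * (r + s))%:R) - lconst (r%:R / (r + s)%:R)) 1.
  apply: (transform_spec_gauge hk r_gt0 TG).
  by rewrite /fourier_g opprD addrA.
have [s0|s_gt0] := posnP s.
  have [r1 Fn] := fourier_regular s0.
  exact: (transform_exists_regular hk r_gt0 F_ord hu hFu s0 r1 Fn).
exact: (transform_exists_irregular hk r_gt0 F_ord hu hFu s_gt0).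
Qed.

Lemma fourier_g_class (u u' : puiseux k (r + s)) :
  fourier_sol F u -> fourier_sol F u' ->
  Rclass (fourier_g F u) = Rclass (fourier_g F u').
Proof.
move=> /fourier_solP[hu du] /fourier_solP[hu' du'].
have [eta etaN u'E] := sol_conj hk r_gt0 F_ord hu hu' du du'.
have eta0 : eta != 0.
  by apply: contra_eq_neq etaN => ->; rewrite expr0n gtn_eqF // eq_sym oner_neq0.
apply/RclassP; exists eta, 0; rewrite ramdegE //; split=> //.
rewrite mulr0z mul0r lconst0 subr0 /fourier_g u'E -twist_lcomp // twistD.
by rewrite twist_mono expr0z mul1r subrr; exact: lbound0.
Qed.

(** If g came from K_q' with q' < N, its polar part, which is that of F(u), would be supported on
    multiples of d = N / gcd(N, q'), hence of a prime [p] dividing d. The polar part of [F] would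
    inherit this support while [p] divides [r], against the assumption on the class of [F]. *)
Lemma fourier_g_circ (u : puiseux k (r + s)) :
  fourier_sol F u -> Rcirc (Rclass (fourier_g F u)).
Proof.
case/fourier_solP => hu du q' /andP[q'0 q'N] [g' [h [g'g hE]]].
have [s0|s_gt0] := posnP s.
  by have [r1 _] := fourier_regular s0; rewrite r1 s0 in q'N; lia.
pose d := (N %/ gcdn N q')%N.
have gN : (gcdn N q' %| N)%N := dvdn_gcdl _ _.
have g_gt0 : (0 < gcdn N q')%N by rewrite gcdn_gt0 q'0 orbT.
have d_gt1 : (1 < d)%N.
  rewrite ltn_divRL // mul1n; apply: leq_ltn_trans q'N.
  exact: dvdn_leq (dvdn_gcdr _ _).
have [p p_pr pd] := pdivP d_gt1.
have pN : (p %| N)%N by apply: dvdn_trans pd (dvdn_div gN).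
have d_dvd a : (N %| a * q')%N -> (d %| a)%N.
  move=> Na; rewrite dvdn_divLR // muln_gcdr dvdn_gcd.
  by rewrite Na dvdn_mull.
have supp (n : int) : n < 0 -> ~~ (p %| n)%Z -> lcomp F u n = 0.
  move=> n0 pn; have /RclassP[eta [m [_ /(_ n)]]] := g'g.
  have nneq0 : n == 0 = false := lt_eqF n0.
  rewrite !lcoefB twistE lcoefD /= nneq0 subr0 addr0 => E.
  have g'n : g' n = 0.
    have := congr1 (fun a : laurent k => a (n * (ramdeg q')%:Z)) hE.
    rewrite ramify_mul => ->.
    (* Inside the common extension of degree N q', the exponent [n] becomes n q', which is a
       multiple of [N] only if d divides [n]. *)
    rewrite ramify_dvd // !ramdegE //; apply: contra pn; rewrite !dvdzE abszM /=.
    by move/d_dvd; exact: dvdn_trans.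
  by have := E (_ : n < 1); rewrite g'n mulr0 subr0; apply; lia.
have pr := sol_support_dvd s_gt0 F_ord hu pN supp.
apply: (Rcirc_support r_gt0 p_pr pr F_circ).
exact: (sol_support hk r_gt0 s_gt0 F_ord hu du p_pr pN supp).
Qed.

End Main.

Theorem theorem3p1 (k : closedFieldType) (hk : [pchar k] =i pred0)
    (s r : nat) (r_gt0 : (0 < r)%N) (F : puiseux k r)
    (F_circ : Rcirc (Rclass F)) (F_ord : lorder F (- s%:Z))
    (F_neq0 : Rclass F <> Rclass 0) :
  [/\ no_horizontal (elem_conn hk F),
      exists W : connection k, fourier_0oo (elem_conn hk F) W,
      exists u : puiseux k (r + s), fourier_sol F u,
      forall u u' : puiseux k (r + s), fourier_sol F u -> fourier_sol F u' ->
        Rclass (fourier_g F u) = Rclass (fourier_g F u')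
    & forall u : puiseux k (r + s), fourier_sol F u ->
        Rcirc (Rclass (fourier_g F u)) /\
        forall W : connection k, fourier_0oo (elem_conn hk F) W ->
          conn_isom W (elem_conn hk (fourier_g F u))].
Proof.
have spec := @fourier_transform_spec k hk s r r_gt0 F F_circ F_ord F_neq0.
have [u0 [hu0 du0]] := sol_exists hk r_gt0 F_ord.
have su0 : fourier_sol F (u0 : puiseux k (r + s)) by apply/fourier_solP.
have [T0 T0P] := spec _ su0.
have four0 := transform_fourier hk r_gt0 T0P.
split; [by case: four0| |by exists u0| |].
- by exists (elem_conn hk (fourier_g F (u0 : puiseux k (r + s)))).
- exact: (fourier_g_class hk r_gt0 F_ord).
move=> u su; split; first exact: (fourier_g_circ hk r_gt0 F_circ F_ord F_neq0 su).
(* [W] and E_g are two local Fourier transforms of the same connection, so uniqueness applies. *)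
move=> W [nh [phi' [psi' H']]]; have [T TP] := spec _ su.
have [_ [phi [psi H]]] := transform_fourier hk r_gt0 TP.
exact: (fourier_unique nh H H').
Qed.
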